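(* Let $f:\mathbb{R}^d\to\mathbb{R}$ satisfy A1 and A2 on $\mathcal{X}_a^b$ for some $0\le a<b\le\infty$, and let $\theta_t=(m_t,\sigma_t,\Sigma_t)$ be generated by the (1+1)-ES$_\kappa$ minimizing $f$, with $m_0\in\mathcal{X}_a^b$. Let $p_u,p_\ell$ satisfy $0<p_u<p_{\mathrm{target}}<p_\ell<p^{\mathrm{limit}}$ and $p_\ell+p_u=2p_{\mathrm{target}}$. Then there exist $0<\ell\le\bar\sigma_\ell$ and $u\ge\bar\sigma_u$ with $u/\ell\ge\alpha_\uparrow/\alpha_\downarrow$ such that the following holds for every $A>0$ and every $v$ with $0<v<\min\{1,A/\log(1/\alpha_\downarrow),A/\log(\alpha_\uparrow)\}$ for which $$B=\min\Big\{A\,p^*_r-v\log\tfrac{\alpha_\uparrow}{\alpha_\downarrow},\ v\,\tfrac{p_\ell-p_u}{2}\log\tfrac{\alpha_\uparrow}{\alpha_\downarrow}\Big\}$$ satisfies $A>B>0$, where $r=1-\exp(-\frac{A}{1-v})$ and $p^*_r=\inf_{\bar\sigma\in[\ell,u]}\inf_{m\in\mathcal{X}_a^b}\inf_{\Sigma\in\mathcal{S}_\kappa}p^{\mathrm{succ}}_r(\bar\sigma;m,\Sigma)$. For every $\epsilon>0$ with $a\le\epsilon<f_\mu(m_0)\le b$, the first hitting time $T_\epsilon=\min\{t:f_\mu(m_t)\le\epsilon\}$ satisfies $$\mathbb{E}[T_\epsilon]\le\frac{V(\theta_0)-\log(\epsilon)+A}{B},$$ equivalently $\mathbb{E}[T_\epsilon]\le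 C_T+C_R^{-1}\log(f_\mu(m_0)/\epsilon)$ with $C_R=B$ and $$C_T=\frac AB+\frac vB\max\Big\{0,\ \log\Big(\frac{\alpha_\uparrow\,\ell\, f_\mu(m_0)}{\sigma_0}\Big),\ \log\Big(\frac{\sigma_0}{\alpha_\downarrow\, u\, f_\mu(m_0)}\Big)\Big\}.$$ Moreover, if $x^*$ is a global minimizer of $f$, the same quantity is an upper bound on the expected first hitting time of $[0,2C_u\epsilon]$ by $\|m_t-x^*\|$.
   Context: Algorithm. Let $d\in\mathbb{N}$, $\kappa\ge1$, $\alpha_\uparrow>1>\alpha_\downarrow>0$, $p_{\mathrm{target}}=\frac{\log(1/\alpha_\downarrow)}{\log(\alpha_\uparrow/\alpha_\downarrow)}$. $\mathcal{S}_\kappa$ is the set of symmetric positive-definite $d\times d$ matrices with determinant $1$ and condition number at most $\kappa$. The (1+1)-ES$_\kappa$ started from $(m_0,\sigma_0,\Sigma_0)\in\mathbb{R}^d\times(0,\infty)\times\mathcal{S}_\kappa$ iterates: conditionally on the past (natural filtration $\mathcal{F}_t$ of $(m_t,\sigma_t,\Sigma_t)_t$) sample $x_t\sim\mathcal{N}(m_t,\sigma_t^2\Sigma_t)$; if $f(x_t)\le f(m_t)$ set $m_{t+1}=x_t$, $\sigma_{t+1}=\alpha_\uparrow\sigma_t$; otherwise set $m_{t+1}=m_t$, $\sigma_{t+1}=\alpha_\downarrow\sigma_t$. In both cases $\Sigma_{t+1}$ is chosen in $\mathcal{S}_\kappa$ by an arbitrary comparison-based rule (unchanged if $f$ is replaced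 by $g\circ f$ with $g$ strictly increasing); nothing else is assumed about it. Spatial suboptimality function: $f_\mu(x)=\big(\mu(\{y\in\mathbb{R}^d: f(y)\le f(x)\})\big)^{1/d}\in[0,\infty]$, $\mu$ Lebesgue measure. $\mathcal{X}_a^b=\{x\in\mathbb{R}^d: a<f_\mu(x)\le b\}$. Success probability: for $r\in[0,1]$, $S_r(m)=\{x: f_\mu(x)\le(1-r)f_\mu(m)\}$ and $p^{\mathrm{succ}}_r(\bar\sigma;m,\Sigma)=\Pr_{z\sim\mathcal{N}(0,\Sigma)}[m+f_\mu(m)\bar\sigma z\in S_r(m)]$. $p^{\mathrm{lower}}_{(a,b]}(\bar\sigma)=\inf_{m\in\mathcal{X}_a^b}\inf_{\Sigma\in\mathcal{S}_\kappa}p^{\mathrm{succ}}_0(\bar\sigma;m,\Sigma)$ and $p^{\mathrm{upper}}_{(a,b]}(\bar\sigma)=\sup_{m\in\mathcal{X}_a^b}\sup_{\Sigma\in\mathcal{S}_\kappa}p^{\mathrm{succ}}_0(\bar\sigma;m,\Sigma)$. Given $p_\ell,p_u$: $\bar\sigma_\ell=\sup\{\bar\sigma>0:p^{\mathrm{lower}}_{(a,b]}(\bar\sigma)\ge p_\ell\}$, $\bar\sigma_u=\inf\{\bar\sigma>0:p^{\mathrm{upper}}_{(a,b]}(\bar\sigma)\le p_u\}$. A1 (on $\mathcal{X}_a^b$): $f$ is measurable and there are constants $C_\ell,C_u>0$ such that for every $m\in\mathcal{X}_a^b$ there are an open ball $\mathcal{B}_\ell$ of radius $C_\ell f_\mu(m)$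 and a closed ball $\bar{\mathcal{B}}_u$ of radius $C_u f_\mu(m)$ (arbitrary centers) with $\mathcal{B}_\ell\subseteq\{x:f_\mu(x)<f_\mu(m)\}$ and $\{x:f_\mu(x)\le f_\mu(m)\}\subseteq\bar{\mathcal{B}}_u$. A2 (on $\mathcal{X}_a^b$): $f$ is measurable and there is $p^{\mathrm{limit}}>p_{\mathrm{target}}$ with $\liminf_{\bar\sigma\downarrow0}p^{\mathrm{lower}}_{(a,b]}(\bar\sigma)\ge p^{\mathrm{limit}}$. Potential function, for $\theta=(m,\sigma,\Sigma)$: $V(\theta)=\log(f_\mu(m))+\max\Big\{0,\ v\log\frac{\alpha_\uparrow\ell f_\mu(m)}{\sigma},\ v\log\frac{\sigma}{\alpha_\downarrow u f_\mu(m)}\Big\}$.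
   Formalization: In the last sentence (hitting time of [0,2C_uε] by ‖m_t−x*‖), when a>0 it is additionally assumed that the infimum of f_μ over X_a^b is at most ε; without this the claim is false, as f_μ may jump over ε. *)

(* Defs.v *)
From HB Require Import structures.
From mathcomp Require Import all_boot all_order all_algebra.
From mathcomp Require Import all_classical all_reals all_analysis.
Set Implicit Arguments.
Unset Strict Implicit.
Unset Printing Implicit Defensive.
Import Order.TTheory GRing.Theory Num.Theory.
Import numFieldNormedType.Exports.
Local Open Scope classical_set_scope.
Local Open Scope ring_scope.

(** * Borel structure and Lebesgue measure on row vectors *)

Definition measure_matrix_display : measure_display -> measure_display.
Proof. exact. Qed.

Section measurable_matrix.
Context {d : measure_display} {T : measurableType d} (m n : nat).

(* For [T := R] this is the Borel sigma-algebra of [R^(m * n)]. *)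
Definition mx_measurable : set (set 'M[T]_(m, n)) :=
  <<s \bigcup_(ij in [set: 'I_m * 'I_n])
        preimage_set_system setT (fun A : 'M[T]_(m, n) => A ij.1 ij.2)
          measurable >>.

Let mx_measurable0 : mx_measurable set0.
Proof. exact: sigma_algebra0. Qed.

Let mx_measurableC A : mx_measurable A -> mx_measurable (~` A).
Proof. exact: sigma_algebraC. Qed.

Let mx_measurable_bigcup (F : (set 'M[T]_(m, n))^nat) :
  (forall i, mx_measurable (F i)) -> mx_measurable (\bigcup_i (F i)).
Proof. exact: sigma_algebra_bigcup. Qed.

HB.instance Definition _ := @isMeasurable.Build (measure_matrix_display d)
  'M[T]_(m, n) mx_measurable mx_measurable0 mx_measurableC
  mx_measurable_bigcup.

End measurable_matrix.

Lemma measurable_fun_entry d (T : measurableType d) m n i j :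
  measurable_fun [set: 'M[T]_(m, n)] (fun A => A i j).
Proof.
move=> _ B mB; apply: sub_sigma_algebra.
by exists (i, j) => //; exists B.
Qed.

Lemma measurable_fun_mxP d d' (T : measurableType d) (U : measurableType d')
    m n (f : U -> 'M[T]_(m, n)) :
  (forall i j, measurable_fun setT (fun u => f u i j)) ->
  measurable_fun setT f.
Proof.
move=> mf; apply: measurability => //.
move=> _ [_ [[i j] _ [B mB <-]] <-].
have := mf i j measurableT B mB.
by rewrite !setTI.
Qed.

Section lebesgue_rV.
Context {R : realType}.

Definition cons_rV n (p : measurableTypeR R * 'rV[R]_n) : 'rV[R]_n.+1 :=
  row_mx (p.1%:M : 'M[R]_1) p.2.

Definition uncons_rV n (x : 'rV[R]_n.+1) : measurableTypeR R * 'rV[R]_n :=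
  (x 0 0, rsubmx (x : 'rV[R]_(1 + n))).

Lemma cons_rVK n : cancel (@cons_rV n) (@uncons_rV n).
Proof.
case=> a v; rewrite /uncons_rV /cons_rV /= row_mxKr; congr pair.
have -> : (0 : 'I_n.+1) = lshift n (0 : 'I_1) by apply/val_inj.
by rewrite (row_mxEl (a%:M : 'M[R]_1) v) mxE eqxx mulr1n.
Qed.

Lemma measurable_cons_rV n : measurable_fun setT (@cons_rV n).
Proof.
apply: measurable_fun_mxP => i j.
have [k ->|k ->] := split_ordP (j : 'I_(1 + n)).
  apply: (eq_measurable_fun (fun p : measurableTypeR R * 'rV[R]_n => p.1)) => [[a v] _|]; last exact: measurable_fst.
  by rewrite /cons_rV (row_mxEl (a%:M : 'M[R]_1) v) !ord1 mxE eqxx mulr1n.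
apply: (eq_measurable_fun (fun p : measurableTypeR R * 'rV[R]_n => p.2 i k)) => [[a v] _|].
  by rewrite /cons_rV (row_mxEr (a%:M : 'M[R]_1) v).
by apply: measurableT_comp (measurable_fun_entry i k) _; exact: measurable_snd.
Qed.

Lemma measurable_uncons_rV n : measurable_fun setT (@uncons_rV n).
Proof.
apply: measurable_fun_pair; first exact: measurable_fun_entry.
apply: measurable_fun_mxP => i j.
apply: (eq_measurable_fun (fun x : 'rV[R]_n.+1 => x i (rshift 1 j))).
  by move=> x _; rewrite mxE.
exact: measurable_fun_entry.
Qed.

Section lebesgue_succ.
Variables (n : nat) (mu : {sigma_finite_measure set 'rV[R]_n -> \bar R}).

(* The image of [lebesgue_measure \x mu] under [R * R^n = R^(n + 1)]. *)
Definition lebesgue_succ : set 'rV[R]_n.+1 -> \bar R :=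
  pushforward (lebesgue_measure \x mu)%E (@cons_rV n).

Let lebesgue_succ0 : lebesgue_succ set0 = 0%E.
Proof. by rewrite /lebesgue_succ /pushforward preimage_set0 measure0. Qed.

Let lebesgue_succ_ge0 A : (0 <= lebesgue_succ A)%E.
Proof. by rewrite /lebesgue_succ /pushforward; exact: measure_ge0. Qed.

Let lebesgue_succ_sigma_additive : semi_sigma_additive lebesgue_succ.
Proof.
exact: (@measure_semi_sigma_additive _ _ _
  (measure_function_pushforward__canonical__measure_function_Measure
     (lebesgue_measure \x mu)%E (@measurable_cons_rV n))).
Qed.

HB.instance Definition _ := isMeasure.Build _ _ _ lebesgue_succ
  lebesgue_succ0 lebesgue_succ_ge0 lebesgue_succ_sigma_additive.

Let sigma_finite_lebesgue_succ : sigma_finite setT lebesgue_succ.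
Proof.
pose lam : {sigma_finite_measure set (measurableTypeR R) -> \bar R} :=
  lebesgue_measure.
have /sigma_finiteP[F [TF ndF Foo]] := sigma_finiteT lam.
have /sigma_finiteP[G [TG ndG Goo]] := sigma_finiteT mu.
exists (fun k => @uncons_rV n @^-1` (F k `*` G k)).
  rewrite -preimage_bigcup; apply/esym/seteqP; split => // x _.
  have [i _ Fi] : (\bigcup_i F i) (uncons_rV x).1 by rewrite -TF.
  have [k _ Gk] : (\bigcup_i G i) (uncons_rV x).2 by rewrite -TG.
  exists (maxn i k) => //; split.
  - by move: Fi; exact/subsetPset/ndF/leq_maxl.
  - by move: Gk; exact/subsetPset/ndG/leq_maxr.
move=> k; have [mF Fk] := Foo k; have [mG Gk] := Goo k; split.
  by rewrite -[_ @^-1` _]setTI; apply: measurable_uncons_rV => //;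
    exact: measurableX.
rewrite /lebesgue_succ /pushforward -comp_preimage.
have -> : @uncons_rV n \o @cons_rV n = id.
  by apply/funext => p /=; rewrite cons_rVK.
rewrite preimage_id (product_measure1E lam mu)//.
by rewrite lte_mul_pinfty// ge0_fin_numE.
Qed.

HB.instance Definition _ :=
  Measure_isSigmaFinite.Build _ _ _ lebesgue_succ sigma_finite_lebesgue_succ.

End lebesgue_succ.

Fixpoint lebesgue_rV n : {sigma_finite_measure set 'rV[R]_n -> \bar R} :=
  match n with
  | 0 => \d_(0 : 'rV[R]_0)
  | n'.+1 => lebesgue_succ (lebesgue_rV n')
  end.

End lebesgue_rV.

(** * Gaussian distributions and covariance matrices *)

Section gaussian.
Context {R : realType} {d : nat}.
Implicit Types (m x : 'rV[R]_d) (C S : 'M[R]_d).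

Definition enorm x : R := Num.sqrt ((x *m x^T) 0 0).

Definition gauss_pdf m C x : R :=
  expR (- ((x - m) *m invmx C *m (x - m)^T) 0 0 / 2) /
  Num.sqrt ((2 * pi) ^+ d * \det C).

(* [N(m, C)] for a positive-definite covariance matrix [C] *)
Definition gauss m C (B : set 'rV[R]_d) : \bar R :=
  (\int[lebesgue_rV d]_(x in B) (gauss_pdf m C x)%:E)%E.

Definition spd S : Prop :=
  S^T = S /\ forall x, x != 0 -> 0 < (x *m S *m x^T) 0 0.

Definition cond_num S : R :=
  sup [set l | eigenvalue S l] / inf [set l | eigenvalue S l].

Definition Skappa (kappa : R) : set 'M[R]_d :=
  [set S | [/\ spd S, \det S = 1 & cond_num S <= kappa]].

End gaussian.

(** * Spatial suboptimality and success probabilities *)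

Section suboptimality.
Context {R : realType} {d : nat}.
Variable f : 'rV[R]_d -> R.
Implicit Types (m x : 'rV[R]_d) (S : 'M[R]_d) (a : R) (b : \bar R).
Local Open Scope ereal_scope.

Definition fmu x : \bar R :=
  (lebesgue_rV d [set y | (f y <= f x)%R]) `^ (d%:R^-1).

Definition Xab a b : set 'rV[R]_d := [set x | a%:E < fmu x <= b].

(* The radii [C * fmu m] are extended reals; a ball of infinite radius is the
   whole space. Hence [A1] rules out points of [Xab a +oo] with
   [fmu m = +oo]. *)
Definition A1 a b (Cl Cu : R) : Prop :=
  [/\ measurable_fun setT f, (0 < Cl)%R, (0 < Cu)%R &
    forall m, Xab a b m -> exists cl cu : 'rV[R]_d,
      [set y | (enorm (y - cl))%:E < Cl%:E * fmu m] `<=`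
        [set x | fmu x < fmu m] /\
      [set x | fmu x <= fmu m] `<=`
        [set y | (enorm (y - cu))%:E <= Cu%:E * fmu m]].

Definition Sr (r : R) m : set 'rV[R]_d :=
  [set x | fmu x <= (1 - r)%:E * fmu m].

Definition psucc (r sb : R) m S : \bar R :=
  gauss 0 S [set z | Sr r m (m + (fine (fmu m) * sb) *: z)%R].

Definition plower kappa a b (sb : R) : \bar R :=
  ereal_inf [set ereal_inf [set psucc 0 sb m S | S in Skappa kappa]
            | m in Xab a b].

Definition pupper kappa a b (sb : R) : \bar R :=
  ereal_sup [set ereal_sup [set psucc 0 sb m S | S in Skappa kappa]
            | m in Xab a b].

Definition sigbar_l kappa a b (pl : R) : \bar R :=
  ereal_sup [set sb%:E | sb in
    [set sb : R | (0 < sb)%R /\ pl%:E <= plower kappa a b sb]].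

Definition sigbar_u kappa a b (pu : R) : \bar R :=
  ereal_inf [set sb%:E | sb in
    [set sb : R | (0 < sb)%R /\ pupper kappa a b sb <= pu%:E]].

Definition pstar kappa a b (l u r : R) : \bar R :=
  ereal_inf [set
    ereal_inf [set
      ereal_inf [set psucc r sb m S | S in Skappa kappa]
    | m in Xab a b]
  | sb in `[l, u]%classic].

Definition ptarget (au ad : R) : R := (ln (1 / ad) / ln (au / ad))%R.

Definition A2 kappa (au ad : R) a b (plim : R) : Prop :=
  [/\ measurable_fun setT f, (ptarget au ad < plim)%R &
    plim%:E <= limf_einf (plower kappa a b) 0^'+].

(* The values of [fmu] on [Xab a b] come down to [eps]; needed only for [0 < a].
   There, [fmu] may jump from at most [a] to more than [eps]: [A1] then says
   nothing about the shape of [{x | fmu x <= eps}], and a point of this set need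
   not be within [2 * Cu * eps] of a minimizer. Example with [d = 1]: [f = 0] on
   [[-1, -.95]], [f = 1] on [(-.95, .95)], [f = 1/2] on [[.95, 1)], [f 1 = -1],
   [f x = |x|] elsewhere, [a = eps = .1], [b = +oo], [Cu = 1/2]; an ES that
   enters [[-1, -.95]] never leaves it and stays away from the minimizer 1. *)
Definition level_reached a b (eps : R) : Prop :=
  (0 < a)%R -> ereal_inf [set fmu m | m in Xab a b] <= eps%:E.

End suboptimality.

(** * The (1+1)-ES *)

Section es.
Context {R : realType} {d : nat}.

Definition state : Type := ('rV[R]_d * R * 'M[R]_d)%type.

(* A rule for the covariance matrix sees the objective function, the states and
   sampled points up to the current iteration (oldest first), and a random seed
   of arbitrary type [E]. *)
Definition cov_rule (E : Type) : Type :=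
  ('rV[R]_d -> R) -> seq (state * 'rV[R]_d) -> E -> 'M[R]_d.

Definition comparison_based E (rule : cov_rule E) : Prop :=
  forall (f : 'rV[R]_d -> R) (g : R -> R), {homo g : y z / y < z} ->
  forall h e, rule (g \o f) h e = rule f h e.

Section run.
Context {dO : measure_display} {O : measurableType dO} (P : probability O R).
Variables (m : nat -> {RV P >-> 'rV[R]_d}) (sg : nat -> {RV P >-> R}).
Variables (Sig : nat -> {RV P >-> 'M[R]_d}) (x : nat -> {RV P >-> 'rV[R]_d}).

Definition theta (t : nat) (w : O) : 'rV[R]_d * R * 'M[R]_d :=
  (m t w, sg t w, Sig t w).

Definition natural_filtration (t : nat) : set (set O) :=
  <<s \bigcup_(s in [set s | (s <= t)%N])
        preimage_set_system setT (theta s) measurable >>.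

Definition history (t : nat) (w : O) : seq (state * 'rV[R]_d) :=
  [seq (theta s w, x s w) | s <- iota 0 t.+1].

(* [es_sample] says that the law of [x t] conditionally on
   [natural_filtration t] is [N(m t, (sg t)^2 Sig t)]. *)
Record es_run (kappa au ad : R) (f : 'rV[R]_d -> R) (m0 : 'rV[R]_d) (s0 : R)
    (S0 : 'M[R]_d) (E : Type) (rule : cov_rule E) (seed : nat -> O -> E)
    : Prop := {
  es_init : forall w, theta 0 w = (m0, s0, S0) ;
  es_sample : forall t A B, natural_filtration t A -> measurable B ->
    (P (A `&` x t @^-1` B) =
     \int[P]_(w in A) gauss (m t w) (sg t w ^+ 2 *: Sig t w)%R B)%E ;
  es_success : forall t w, f (x t w) <= f (m t w) ->
    m t.+1 w = x t w /\ sg t.+1 w = au * sg t w ;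
  es_failure : forall t w, f (m t w) < f (x t w) ->
    m t.+1 w = m t w /\ sg t.+1 w = ad * sg t w ;
  es_rule : comparison_based rule ;
  es_rule_Skappa : forall g h e, Skappa kappa (rule g h e) ;
  es_cov : forall t w, Sig t.+1 w = rule f (history t w) (seed t w)
}.

End run.

Definition potential (f : 'rV[R]_d -> R) (v au ad l u : R) (th : state) : R :=
  let: (m, s, _) := th in
  let phi := fine (fmu f m) in
  ln phi + Num.max 0 (Num.max (v * ln (au * l * phi / s))
                              (v * ln (s / (ad * u * phi)))).

(* first time at which [Q] holds, [+oo] if there is none *)
Definition hitting_time (Q : nat -> Prop) : \bar R :=
  ereal_inf [set t%:R%:E | t in [set t | Q t]].

End es.

(* Main.v *)
(** Let V be the potential of the ES and G_t the event f_mu (m_t) > eps; the events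
G_t decrease, and T_eps is the sum of their indicators. On G_t the increment of V,
truncated at - A, is bounded by a variable that takes finitely many values: for
normalized step sizes sigma / f_mu below l or above u it depends on whether the
offspring is accepted, and in between on whether it decreases f_mu by the factor
1 - r. Choosing l below the range where the success probability is at least p_l,
and u above the point from which it is at most p_u, the conditional expectation of
this variable is at most - B. Since V >= ln eps on G_t, the sum of the increments up
to T_eps is at least ln eps - A - V_0, and taking expectations bounds B E[T_eps].

Large step sizes fail because the Gaussian density with determinant-one covariance
is at most 1 and the level set of m has volume f_mu(m)^d: the success probability is
at most sigma^-d, so that the outer ball of A1 is only used for the distance
to the minimizer. *)
Require Import Defs.
From HB Require Import structures.
From mathcomp Require Import all_boot all_order all_algebra.
From mathcomp Require Import all_classical all_reals all_analysis.
From mathcomp Require Import measurable_realfun ring lra.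
Set Implicit Arguments.
Unset Strict Implicit.
Unset Printing Implicit Defensive.
Import Order.TTheory GRing.Theory Num.Theory.
Import numFieldNormedType.Exports.
Local Open Scope classical_set_scope.
Local Open Scope ring_scope.

(** * Lebesgue measure under translations and scalings *)

Section affine_change_of_variables.
Context {R : realType}.
Implicit Types (c : R) (n : nat).

Lemma measurable_affineR (t c : R) : measurable_fun [set: R] (fun y => t + c * y).
Proof. by apply: measurable_funD => //; exact: measurable_funM. Qed.

(** By uniqueness of Lebesgue measure: [c] times the pushforward under [y |-> t + c * y] agrees with
    it on half-open intervals. *)
Lemma lebesgue_measure_affine (t c : R) (B : set (measurableTypeR R)) :
  0 < c -> measurable B ->
  lebesgue_measure ((fun y : measurableTypeR R => t + c * y) @^-1` B) =
  (c^-1%:E * lebesgue_measure B)%E.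
Proof.
move=> c0 mB.
pose h : measurableTypeR R -> measurableTypeR R := fun y => t + c * y.
have mh : measurable_fun setT h by exact: measurable_affineR.
pose nu := mscale (NngNum (ltW c0)) (measure_function_pushforward__canonical__measure_function_Measure
     (@lebesgue_measure R) mh).
have nuE X : ocitv X -> lebesgue_measure X = nu X.
  move=> [[a b]] _ <-.
  rewrite /nu /mscale/= /pushforward.
  have -> : h @^-1` `]a, b]%classic = `]((a - t) / c), ((b - t) / c)]%classic.
    apply/seteqP; split => y; rewrite /= !in_itv/= /h ltr_pdivrMr// ler_pdivlMr//;
      by rewrite ltrBlDl lerBrDl (mulrC y).
  rewrite !lebesgue_measure_itv/= !lte_fin ltr_pM2r ?invr_gt0// ltrD2r.
  case: ifPn => _; last by rewrite mule0.
  rewrite -!EFinD -EFinM; congr EFin; field; lra.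
rewrite (lebesgue_measure_unique nuE mB) /nu /mscale/= /pushforward muleA.
by rewrite -EFinM mulVf ?gt_eqF// mul1e.
Qed.

Lemma measurable_affine_rV n (t : 'rV[R]_n) c :
  measurable_fun setT (fun z : 'rV[R]_n => t + c *: z).
Proof.
apply: measurable_fun_mxP => i j.
rewrite (_ : (fun _ => _) = fun z : 'rV[R]_n => t i j + c * z i j); last first.
  by apply/funext => z; rewrite !mxE.
apply: measurable_funD => //; apply: measurable_funM => //.
exact: measurable_fun_entry.
Qed.

Lemma uncons_rVK n : cancel (@uncons_rV R n) (@cons_rV R n).
Proof.
move=> y; apply/rowP => j.
have [k ->|k ->] := split_ordP (j : 'I_(1 + n)).
  rewrite /cons_rV (row_mxEl (y 0 0)%:M) !ord1 mxE eqxx mulr1n/=.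
  by congr (y _ _); apply/val_inj.
by rewrite /cons_rV (row_mxEr (y 0 0)%:M) mxE.
Qed.

Lemma affine_cons_rV n (t : 'rV[R]_n.+1) c a (z : 'rV[R]_n) :
  t + c *: cons_rV (a, z) =
  cons_rV ((uncons_rV t).1 + c * a, (uncons_rV t).2 + c *: z).
Proof.
apply: (can_inj (@uncons_rVK n)); rewrite cons_rVK /uncons_rV /=; congr pair.
  rewrite mxE [X in _ + X]mxE; congr (_ + c * _).
  exact: (congr1 fst (cons_rVK (a, z))).
rewrite linearD linearZ/=; congr (_ + c *: _).
exact: (congr1 snd (cons_rVK (a, z))).
Qed.

(** Induction on the dimension. In the coordinates of [cons_rV] the map acts separately on head and
    tail, and [c ^+ n.+1] times its pushforward agrees with the product measure on rectangles, which
    determine that measure. *)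
Lemma lebesgue_rV_affine n (t : 'rV[R]_n) c (B : set 'rV[R]_n) :
  0 < c -> measurable B ->
  lebesgue_rV n ((fun z => t + c *: z) @^-1` B) =
  ((c ^- n)%:E * lebesgue_rV n B)%E.
Proof.
move=> c0; elim: n t B => [|n IH] t B mB.
  rewrite expr0 invr1 mul1e /=; congr (_%:E); congr (\1_ _ _).
  by apply/seteqP; split => y; rewrite /preimage/= [_ + _](thinmx0 _) [y](thinmx0 _).
pose h (p : measurableTypeR R * 'rV[R]_n) : measurableTypeR R * 'rV[R]_n :=
  ((uncons_rV t).1 + c * p.1, (uncons_rV t).2 + c *: p.2).
have mh : measurable_fun setT h.
  apply: measurable_fun_pair.
    exact: (measurableT_comp (measurable_affineR _ _)).
  exact: (measurableT_comp (measurable_affine_rV _ _)).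
have cn0 : 0 <= c ^+ n.+1 by rewrite exprn_ge0// ltW.
pose nu := mscale (NngNum cn0)
  (measure_function_pushforward__canonical__measure_function_Measure
     (@lebesgue_measure R \x lebesgue_rV n)%E mh).
pose lam : {sigma_finite_measure set (measurableTypeR R) -> \bar R} :=
    lebesgue_measure.
have nuE X : measurable X -> (lam \x lebesgue_rV n)%E X = nu X.
  apply: product_measure_unique => A1 A2 mA1 mA2.
  pose B1 : set (measurableTypeR R) :=
    (fun y : measurableTypeR R => (uncons_rV t).1 + c * y) @^-1` A1.
  pose B2 : set 'rV[R]_n := (fun z => (uncons_rV t).2 + c *: z) @^-1` A2.
  transitivity ((c ^+ n.+1)%:E * (lam \x lebesgue_rV n) (B1 `*` B2))%E => //.
  rewrite (product_measure1E lam (lebesgue_rV n)); last 2 first.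
  - by rewrite -[X in measurable X]setTI; exact: measurable_affineR.
  - by rewrite -[X in measurable X]setTI; exact: measurable_affine_rV.
  rewrite /lam /= lebesgue_measure_affine// IH//.
  have EA (y z w : R) (X1 X2 : \bar R) :
      (y%:E * (z%:E * X1 * (w%:E * X2)) = (y * z * w)%:E * (X1 * X2))%E.
    by rewrite muleACA !EFinM !muleA.
  rewrite EA exprS (_ : c * c ^+ n / c * _ = 1) ?mul1e//.
  by field; rewrite expf_neq0 ?gt_eqF.
have mconsB : measurable (@cons_rV R n @^-1` B).
  by rewrite -[X in measurable X]setTI; exact: measurable_cons_rV.
transitivity ((lam \x lebesgue_rV n)%E (h @^-1` (@cons_rV R n @^-1` B))).
  rewrite /= /lebesgue_succ /pushforward; congr (_ _).
  by apply/seteqP; split => -[a z]; rewrite /preimage/= affine_cons_rV.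
rewrite [X in (_ * X)%E]/= /lebesgue_succ /pushforward.
rewrite [X in (_ * X)%E](_ : _ = nu (@cons_rV R n @^-1` B)); last exact: nuE.
rewrite /nu /mscale/= /pushforward muleA -EFinM mulVf ?mul1e//.
by rewrite expf_neq0 ?gt_eqF.
Qed.

End affine_change_of_variables.

(** * Measurability of matrix operations and of the Gaussian density *)

Section measurable_matrix_functions.
Context {R : realType} {dU : measure_display} {U : measurableType dU}.

Lemma measurable_invr (g : U -> R) :
  measurable_fun setT g -> measurable_fun setT (fun u => (g u)^-1).
Proof.
move=> mg.
(* Real powers are measurable; where [g u = 0] both sides vanish by the convention [0^-1 = 0]. *)
rewrite (_ : (fun _ => _) = fun u => g u * (g u ^+ 2) `^ (-1)); last first.
  apply/funext => u; rewrite powR_inv1 ?sqr_ge0// expr2 invfM.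
  have [->|g0] := eqVneq (g u) 0; first by rewrite invr0 mul0r.
  by rewrite mulrA mulfV// mul1r.
apply: measurable_funM => //.
apply: (measurableT_comp (measurable_powR (R := R) (-1))).
exact: measurable_funM.
Qed.

Lemma measurable_sqrtr (g : U -> R) :
  measurable_fun setT g -> measurable_fun setT (fun u => Num.sqrt (g u)).
Proof.
move=> mg; apply: measurableT_comp => //.
apply: nondecreasing_measurable => // a b; exact: ler_wsqrtr.
Qed.

Lemma measurable_entry m n (A : U -> 'M[R]_(m, n)) i j :
  measurable_fun setT A -> measurable_fun setT (fun u => A u i j).
Proof. by move=> mA; exact: (measurableT_comp (measurable_fun_entry i j) mA). Qed.

Lemma measurable_mulmx m n p (A : U -> 'M[R]_(m, n)) (B : U -> 'M[R]_(n, p)) :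
  measurable_fun setT A -> measurable_fun setT B ->
  measurable_fun setT (fun u => A u *m B u).
Proof.
move=> mA mB; apply: measurable_fun_mxP => i j.
under eq_fun do rewrite mxE.
apply: measurable_sum => k.
by apply: measurable_funM; exact: measurable_entry.
Qed.

Lemma measurable_trmx m n (A : U -> 'M[R]_(m, n)) :
  measurable_fun setT A -> measurable_fun setT (fun u => (A u)^T).
Proof.
move=> mA; apply: measurable_fun_mxP => i j.
by under eq_fun do rewrite mxE; exact: measurable_entry.
Qed.

Lemma measurable_subrmx m n (A B : U -> 'M[R]_(m, n)) :
  measurable_fun setT A -> measurable_fun setT B ->
  measurable_fun setT (fun u => A u - B u).
Proof.
move=> mA mB; apply: measurable_fun_mxP => i j.
under eq_fun do rewrite !mxE.
by apply: measurable_funB; exact: measurable_entry.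
Qed.

Lemma measurable_scalemx m n (c : U -> R) (A : U -> 'M[R]_(m, n)) :
  measurable_fun setT c -> measurable_fun setT A ->
  measurable_fun setT (fun u => c u *: A u).
Proof.
move=> mc mA; apply: measurable_fun_mxP => i j.
under eq_fun do rewrite mxE.
by apply: measurable_funM => //; exact: measurable_entry.
Qed.

Lemma measurable_determinant n (A : U -> 'M[R]_n) :
  measurable_fun setT A -> measurable_fun setT (fun u => \det (A u)).
Proof.
move=> mA; rewrite /determinant; apply: measurable_sum => s.
apply: measurable_funM => //.
by apply: measurable_prod => i _; exact: measurable_entry.
Qed.

(** [invmx] is the adjugate divided by the determinant where the latter is nonzero and returns its
    argument elsewhere; the two cases are glued along a measurable set. *)
Lemma measurable_invmx n (A : U -> 'M[R]_n) :
  measurable_fun setT A -> measurable_fun setT (fun u => invmx (A u)).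
Proof.
move=> mA; rewrite /invmx.
have mdet := measurable_determinant mA.
apply: measurable_fun_ifT => //.
  rewrite (_ : (fun _ => _) = fun u => ~~ (\det (A u) == 0)); last first.
    by apply/funext => u; rewrite unitmxE unitfE.
  by apply: measurableT_comp => //; exact: measurable_fun_eqr.
apply: measurable_scalemx; first exact: measurable_invr.
apply: measurable_fun_mxP => i j.
under eq_fun do rewrite mxE.
apply: measurable_funM => //.
apply: measurable_determinant; apply: measurable_fun_mxP => k l.
by under eq_fun do rewrite !mxE; exact: measurable_entry.
Qed.

Lemma measurable_gauss_pdf d (m x : U -> 'rV[R]_d) (C : U -> 'M[R]_d) :
  measurable_fun setT m -> measurable_fun setT C -> measurable_fun setT x ->
  measurable_fun setT (fun u => gauss_pdf (m u) (C u) (x u)).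
Proof.
move=> mm mC mx; apply: measurable_funM; last first.
  apply: measurable_invr; apply: measurable_sqrtr.
  apply: measurable_funM => //.
  exact: measurable_determinant.
apply: measurableT_comp => //; apply: measurable_funM => //.
apply: measurableT_comp => //; apply: measurable_entry.
have mxm := measurable_subrmx mx mm.
apply: measurable_mulmx; last exact: measurable_trmx.
by apply: measurable_mulmx => //; exact: measurable_invmx.
Qed.

End measurable_matrix_functions.

(** * Bounds and change of variables for Gaussian laws *)

Section gaussian_measure.
Context {R : realType} {d : nat}.
Implicit Types (m x z : 'rV[R]_d) (S C : 'M[R]_d) (B : set 'rV[R]_d).

Lemma gauss_pdf_ge0 m C x : 0 <= gauss_pdf m C x.
Proof. by rewrite divr_ge0 ?expR_ge0 ?sqrtr_ge0. Qed.

Lemma measurable_EFin_gauss_pdf m C B :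
  measurable_fun B (fun x => (gauss_pdf m C x)%:E).
Proof.
apply: measurable_funTS; apply/measurable_EFinP.
exact: measurable_gauss_pdf.
Qed.

(** With [y = x *m invmx S], the quadratic form of the inverse at [x] is that of [S] at [y]. *)
Lemma spd_invmx_ge0 S x : spd S -> S \in unitmx ->
  0 <= (x *m invmx S *m x^T) 0 0.
Proof.
move=> [symS posS] uS; set y := x *m invmx S.
have -> : x^T = S *m y^T.
  by rewrite /y trmx_mul trmx_inv symS mulmxA mulmxV// mul1mx.
rewrite mulmxA; have [->|/posS/ltW//] := eqVneq y 0.
by rewrite !mul0mx mxE.
Qed.

(** The exponent is nonpositive and the normalizing constant [sqrt ((2 pi)^d)] is at least 1. *)
Lemma gauss_pdf_le1 m S x : spd S -> \det S = 1 -> gauss_pdf m S x <= 1.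
Proof.
move=> spdS detS; rewrite /gauss_pdf detS mulr1.
have uS : S \in unitmx by rewrite unitmxE detS unitr1.
have pi1 : 1 <= Num.sqrt ((2 * pi) ^+ d : R).
  rewrite -[leLHS]sqrtr1 ler_wsqrtr// exprn_ege1//.
  by have := @pi_ge2 R; lra.
rewrite ler_pdivrMr ?mul1r; last exact: lt_le_trans pi1.
apply: le_trans pi1; rewrite -expR0 ler_expR mulNr oppr_le0.
by rewrite divr_ge0// spd_invmx_ge0.
Qed.

Lemma gauss_pdf_affine m S s z : 0 < s -> S \in unitmx ->
  gauss_pdf m (s ^+ 2 *: S) (m + s *: z) = s ^- d * gauss_pdf 0 S z.
Proof.
move=> s0 uS; have s2u : s ^+ 2 \is a GRing.unit.
  by rewrite unitfE expf_neq0 ?gt_eqF.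
rewrite /gauss_pdf (addrC m) addrK subr0 invmxZ//; last first.
  by rewrite unitmxZ.
have -> : s *: z *m ((s ^+ 2)^-1 *: invmx S) *m (s *: z)^T =
    z *m invmx S *m z^T.
  rewrite (_ : (s *: z)^T = s *: z^T); last by rewrite linearZ.
  rewrite -scalemxAr -scalemxAr -!scalemxAl !scalerA.
  by rewrite (_ : _ * _ = 1) ?scale1r//; field; rewrite gt_eqF.
rewrite detZ -exprM mulnC exprM mulrCA sqrtrM ?sqr_ge0// sqrtr_sqr ger0_norm; last first.
  by rewrite exprn_ge0 ?ltW.
by rewrite invfM mulrCA.
Qed.

(** Links the law of the offspring to the normalized form in [psucc]: the Jacobian [s ^+ d] of the
    substitution cancels the factor [s ^- d] of the density. *)
Lemma gauss_affine m S s B : 0 < s -> S \in unitmx -> measurable B ->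
  gauss m (s ^+ 2 *: S) B = gauss 0 S [set z | B (m + s *: z)].
Proof.
move=> s0 uS mB; pose h z := m + s *: z.
have mh : measurable_fun setT h by exact: measurable_affine_rV.
have mhB : measurable (h @^-1` B) by rewrite -[X in measurable X]setTI; exact: mh.
have sd0 : 0 < s ^+ d by rewrite exprn_gt0.
pose nu : {measure set 'rV[R]_d -> \bar R} :=
  measure_function_pushforward__canonical__measure_function_Measure
     (lebesgue_rV d) mh.
have pdf0 C x : (0 <= (gauss_pdf m C x)%:E)%E by rewrite lee_fin gauss_pdf_ge0.
rewrite /gauss -[RHS]/(\int[_]_(x in h @^-1` B) _)%E.
(* Lebesgue measure is rewritten as [s ^+ d] times its pushforward under [h], so that the
   substitution becomes integration against a pushforward. *)
transitivity (\int[mscale (NngNum (ltW sd0)) nu]_(x in B)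
    (gauss_pdf m (s ^+ 2 *: S) x)%:E)%E.
  apply: eq_measure_integral => A mA _.
  rewrite -[RHS]/((s ^+ d)%:E * lebesgue_rV d (h @^-1` A))%E.
  by rewrite lebesgue_rV_affine// muleA -EFinM mulfV ?gt_eqF// mul1e.
rewrite ge0_integral_mscale//; last exact: measurable_EFin_gauss_pdf.
rewrite [X in (_ * X)%E](ge0_integral_pushforward mh)//; last first.
  exact: measurable_EFin_gauss_pdf.
rewrite -ge0_integralZl//=; first last.
- by rewrite lee_fin ltW.
- apply: measurable_funTS.
  by apply: measurableT_comp => //; exact: measurable_EFin_gauss_pdf.
by apply: eq_integral => z _; rewrite /= gauss_pdf_affine// -EFinM mulrA mulfV
  ?gt_eqF// mul1r.
Qed.

Lemma gauss_null m C B : measurable B -> lebesgue_rV d B = 0%E -> gauss m C B = 0%E.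
Proof.
by move=> mB B0; apply: null_set_integral => //; exact: measurable_EFin_gauss_pdf.
Qed.

Lemma gauss_le_lebesgue m S B : spd S -> \det S = 1 -> measurable B ->
  (gauss m S B <= lebesgue_rV d B)%E.
Proof.
move=> spdS detS mB; rewrite -[leRHS]mul1e -integral_cst//.
apply: ge0_le_integral => //.
- by move=> x _; rewrite lee_fin gauss_pdf_ge0.
- exact: measurable_EFin_gauss_pdf.
- by move=> x _; rewrite lee_fin gauss_pdf_le1.
Qed.

End gaussian_measure.

(** * Level sets of [fmu] and their volumes *)

Section suboptimality_levels.
Context {R : realType} {d : nat}.
Variable f : 'rV[R]_d -> R.
Hypotheses (d_gt0 : (0 < d)%N) (mf : measurable_fun setT f).
Implicit Types (m x y : 'rV[R]_d) (S C : 'M[R]_d) (c : R).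

Lemma fmu_ge0 x : (0 <= fmu f x)%E.
Proof. exact: poweR_ge0. Qed.

Lemma measurable_sublevel c : measurable [set y | f y <= c].
Proof.
rewrite (_ : [set _ | _] = setT `&` f @^-1` `]-oo, c]); first exact: mf.
by rewrite setTI; apply/seteqP; split => y; rewrite /= in_itv.
Qed.
Hint Resolve measurable_sublevel : core.

Lemma le_fmu x y : f x <= f y -> (fmu f x <= fmu f y)%E.
Proof.
move=> fxy; apply: gt0_ler_poweR; rewrite ?invr_ge0// ?in_itv/= ?andbT ?measure_ge0 ?leey//.
apply: le_measure; rewrite ?inE// => z /= fz; exact: le_trans fxy.
Qed.

(** Only strict inequalities pass back from [fmu] to [f], since [fmu] can be constant where [f]
    increases. *)
Lemma fmu_lt x y : (fmu f x < fmu f y)%E -> f x < f y.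
Proof. by move=> xy; rewrite ltNge; apply: contraTN xy => /le_fmu; rewrite -leNgt. Qed.

Lemma lebesgue_sublevel_fmu x :
  lebesgue_rV d [set y | f y <= f x] = (fmu f x `^ d%:R)%E.
Proof.
rewrite /fmu -poweRrM mulVf ?poweRe1 ?measure_ge0//.
by rewrite pnatr_eq0 -lt0n.
Qed.

Lemma lebesgue_sublevel_le x c : (fmu f x <= c%:E)%E ->
  (lebesgue_rV d [set y | (f y <= f x)%R] <= (c ^+ d)%:E)%E.
Proof.
move=> xc; have c0 : 0 <= c by rewrite -lee_fin (le_trans (fmu_ge0 x)).
rewrite lebesgue_sublevel_fmu -powR_mulrn// -poweR_EFin.
by apply: gt0_ler_poweR; rewrite ?in_itv/= ?andbT ?fmu_ge0 ?leey// lee_fin c0.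
Qed.

(** A superlevel set of [fmu] is the preimage under [f] of an upward closed set of reals, which is
    an interval and hence measurable. *)
Lemma measurable_fmu : measurable_fun setT (fmu f).
Proof.
apply: (measurability (@ErealGenCInfty.G R)) => [|_ [_] [r] -> <-].
  exact: ErealGenCInfty.measurableE.
rewrite setTI.
pose J := [set z : R | exists2 x, f x <= z & (r%:E <= fmu f x)%E].
rewrite (_ : _ @^-1` _ = setT `&` f @^-1` J).
  apply: mf => //; apply: is_interval_measurable => s t /= [x xs rx] _ w.
  by move=> /andP[sw wt]; exists x => //; exact: le_trans sw.
rewrite setTI; apply/seteqP; split => y; rewrite /preimage/= in_itv/= andbT.
  by move=> ry; exists y.
by move=> [x /le_fmu xy rx]; exact: le_trans xy.
Qed.

Lemma measurable_fmu_le (c : \bar R) : measurable [set y | (fmu f y <= c)%E].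
Proof.
rewrite -[X in measurable X]setTI; apply: emeasurable_fun_infty_c => //.
exact: measurable_fmu.
Qed.
Hint Resolve measurable_fmu_le : core.

(* The level set of [fmu] is a countable increasing union of level sets of [f],
   even when the supremum of [f] on it is not attained. *)
Lemma lebesgue_fmu_le c : 0 <= c ->
  (lebesgue_rV d [set y | fmu f y <= c%:E] <= (c ^+ d)%:E)%E.
Proof.
move=> c0; set L := [set y | _].
have mL : measurable L by exact: measurable_fmu_le.
have [[x Lx xmax]|nomax] := pselect (exists2 x, L x & forall y, L y -> f y <= f x).
  apply: le_trans (lebesgue_sublevel_le Lx).
  by apply: le_measure; rewrite ?inE// => y /xmax.
have {}nomax x : L x -> exists2 y, L y & f x < f y.
  move=> Lx; apply: contrapT => ny; apply: nomax; exists x => // y Ly.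
  by rewrite leNgt; apply/negP => xy; apply: ny; exists y.
have [->|/set0P[x0 Lx0]] := eqVneq L set0.
  by rewrite measure0 lee_fin exprn_ge0.
(* Thresholds that exhaust the values of [f] on [L]: [sup - 1 / (n + 1)] if these are bounded above,
   [n] otherwise. Since no maximum is attained, every value lies strictly below the supremum. *)
have [h [ndh hL Lh]] : exists h : nat -> R,
    [/\ {homo h : i j / (i <= j)%N >-> i <= j},
        forall n, exists2 x, L x & h n <= f x &
        forall x, L x -> exists n, f x <= h n].
  have [ub|nub] := pselect (has_ubound (f @` L)).
    have hs : has_sup (f @` L) by split => //; exists (f x0), x0.
    exists (fun n => sup (f @` L) - n.+1%:R^-1); split.
    - by move=> i j ij; rewrite lerB// lef_pV2 ?posrE// ler_nat.
    - move=> n; have n0 : 0 < n.+1%:R^-1 :> R by rewrite invr_gt0.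
      have [_ [x Lx <-] /ltW] := sup_adherent n0 hs.
      by exists x.
    - move=> x Lx; have [y Ly xy] := nomax _ Lx.
      have ys : f y <= sup (f @` L) by apply: sup_upper_bound => //; exists y.
      have sx : 0 < sup (f @` L) - f x by rewrite subr_gt0 (lt_le_trans xy).
      exists (Num.truncn (sup (f @` L) - f x)^-1).
      rewrite lerBrDl -lerBrDr invf_ple ?posrE//.
      exact/ltW/truncnS_gt.
  exists (fun n => n%:R); split.
  - by move=> i j ij; rewrite ler_nat.
  - move=> n; apply: contrapT => nx; apply: nub; exists n%:R => _ [x Lx <-].
    by rewrite leNgt; apply/negP => /ltW nfx; apply: nx; exists x.
  - by move=> x Lx; exists (Num.truncn (f x)).+1; exact/ltW/truncnS_gt.
have LE : L = \bigcup_n [set y | f y <= h n].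
  apply/seteqP; split => [y /Lh[n yn]|y [n _ /= yn]]; first by exists n.
  have [x Lx nx] := hL n; apply: le_trans Lx; apply: le_fmu.
  exact: le_trans nx.
have cvL : (lebesgue_rV d \o (fun n => [set y | f y <= h n])) @ \oo -->
    lebesgue_rV d L.
  rewrite LE; apply: nondecreasing_cvg_mu => //; first exact: bigcupT_measurable.
  move=> i j ij; apply/subsetPset => y /= /le_trans; apply; exact: ndh.
rewrite -(cvg_lim _ cvL)//; apply: lime_le; first by apply/cvg_ex; eexists; exact: cvL.
apply: nearW => n /=; have [x Lx nx] := hL n.
apply: le_trans (lebesgue_sublevel_le Lx).
by apply: le_measure; rewrite ?inE// => y /= /le_trans; apply.
Qed.

Lemma lebesgue_fmu_eq0 : lebesgue_rV d [set y | (fmu f y <= 0)%E] = 0%E.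
Proof.
apply/eqP; rewrite eq_le measure_ge0 andbT.
by have := lebesgue_fmu_le (lexx 0); rewrite expr0n gtn_eqF.
Qed.

Lemma measurable_Sr r m : measurable (Sr f r m).
Proof. exact: measurable_fmu_le. Qed.
Hint Resolve measurable_Sr : core.

Lemma sublevel_sub_Sr0 m : [set y | f y <= f m] `<=` Sr f 0 m.
Proof. by move=> y /le_fmu; rewrite /Sr/= subr0 mul1e. Qed.

Lemma lebesgue_Sr0 m : fmu f m \is a fin_num ->
  (lebesgue_rV d (Sr f 0 m) <= (fine (fmu f m) ^+ d)%:E)%E.
Proof.
move=> fin; rewrite /Sr subr0 mul1e -{1}(fineK fin).
by apply: lebesgue_fmu_le; rewrite fine_ge0 ?fmu_ge0.
Qed.

(** The algorithm compares values of [f], the success probability values of [fmu]. The two level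
    sets are nested and have the same volume [fmu m ^+ d], so they differ by a null set, to which a
    law with a density gives no mass. *)
Lemma gauss_Sr0 m x C : fmu f m \is a fin_num ->
  gauss x C (Sr f 0 m) = gauss x C [set y | f y <= f m].
Proof.
move=> fin; pose N := Sr f 0 m `\` [set y | f y <= f m].
have mN : measurable N by exact: measurableD.
have levelE : lebesgue_rV d [set y | f y <= f m] = (fine (fmu f m) ^+ d)%:E.
  by rewrite lebesgue_sublevel_fmu -{1}(fineK fin) poweR_EFin powR_mulrn// fine_ge0 ?fmu_ge0.
have N0 : lebesgue_rV d N = 0%E.
  apply/eqP; rewrite eq_le measure_ge0 andbT /N measureD//; last first.
    by rewrite (le_lt_trans (lebesgue_Sr0 fin)) ?ltry.
  rewrite setIidr; last exact: sublevel_sub_Sr0.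
  rewrite sube_le0; apply: le_trans (lebesgue_Sr0 fin) _.
  by rewrite -levelE; exact: lexx.
rewrite /gauss (ge0_negligible_integral mN)//; last 2 first.
- exact: measurable_EFin_gauss_pdf.
- by move=> y _; rewrite lee_fin gauss_pdf_ge0.
by rewrite setDD setIidr//; exact: sublevel_sub_Sr0.
Qed.

Lemma psuccE r m S (s : R) : 0 < s -> (0 < fmu f m < +oo)%E -> S \in unitmx ->
  psucc f r (s / fine (fmu f m)) m S = gauss m (s ^+ 2 *: S) (Sr f r m).
Proof.
move=> s0 m0 uS; rewrite gauss_affine// /psucc.
by rewrite mulrCA mulfV ?mulr1// gt_eqF//; exact: fine_gt0.
Qed.

Lemma psucc_le m S (s : R) : 0 < s -> (0 < fmu f m < +oo)%E -> spd S ->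
  \det S = 1 -> (psucc f 0 s m S <= (s ^- d)%:E)%E.
Proof.
move=> s0 m0 spdS detS; have f0 := fine_gt0 m0.
have fin : fmu f m \is a fin_num.
  by case/andP: m0 => ? ?; rewrite ge0_fin_numE ?fmu_ge0.
have fs0 : 0 < fine (fmu f m) * s by rewrite mulr_gt0.
have mh : measurable [set z | Sr f 0 m (m + (fine (fmu f m) * s) *: z)].
  by rewrite -[X in measurable X]setTI; apply: measurable_affine_rV.
apply: le_trans (gauss_le_lebesgue _ spdS detS mh) _.
rewrite [leLHS](lebesgue_rV_affine m fs0 (measurable_Sr 0 m)).
apply: le_trans (lee_wpmul2l _ (lebesgue_Sr0 fin)) _.
  by rewrite lee_fin invr_ge0 exprn_ge0// ltW.
rewrite -EFinM lee_fin exprMn invfM mulrAC mulVf ?mul1r//.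
by rewrite expf_neq0// gt_eqF.
Qed.

End suboptimality_levels.

(** * Success probabilities at small and large step sizes *)

Section step_size_range.
Context {R : realType} {d : nat}.
Variables (f : 'rV[R]_d -> R) (kappa au ad a : R) (b : \bar R) (Cl Cu plim : R).
Hypotheses (d_gt0 : (0 < d)%N) (a_ge0 : 0 <= a) (HA1 : A1 f a b Cl Cu).

(** An infinite value would make the inner ball of [A1] the whole space; it would contain [m] itself
    and force [fmu m < fmu m]. *)
Lemma Xab_fmu m : Xab f a b m -> (0 < fmu f m < +oo)%E.
Proof.
case: HA1 => _ Cl0 _ balls /andP[am mb]; apply/andP; split.
  by apply: le_lt_trans am; rewrite lee_fin.
rewrite ltey; apply/negP => /eqP moo.
have [cl [_ [+ _]]] := balls m (introT andP (conj am mb)).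
move=> /(_ m) /=; rewrite ltxx; apply/not_implyP; split => //.
by rewrite moo gt0_muley ?lte_fin// ltry.
Qed.

Lemma plower_ge_near0 pl : A2 f kappa au ad a b plim -> pl < plim ->
  exists2 l, 0 < l & forall s, 0 < s -> s <= l -> (pl%:E <= plower f kappa a b s)%E.
Proof.
case=> _ _; rewrite limf_einfE => liminf plplim.
have : (pl%:E < ereal_sup [set ereal_inf (plower f kappa a b @` V) | V in 0^'+])%E.
  by rewrite (lt_le_trans _ liminf)// lte_fin.
move=> /ereal_sup_gt[_ [V + <-]] plV.
rewrite /= /at_right /within/= => /nbhs_ballP[e /= e0 eV].
(* Half the radius, so that the closed condition [s <= e / 2] stays inside the open ball of radius
   [e]. *)
exists (e / 2) => [|s s0 se]; first by rewrite divr_gt0.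
apply: le_trans (ltW plV) _; apply: ereal_inf_lbound; exists s => //.
apply: eV => //; rewrite /ball/= sub0r normrN gtr0_norm//.
by rewrite (le_lt_trans se)// ltr_pdivrMr// ltr_pMr// ltr1n.
Qed.

Lemma pupper_le_large pu : 0 < pu ->
  exists2 u, 0 < u & forall s, u <= s -> (pupper f kappa a b s <= pu%:E)%E.
Proof.
(* For [s >= 1 + 1 / pu] and [d >= 1] one has [s ^+ d >= s >= 1 / pu], so the volume bound [s ^- d]
   is at most [pu]. *)
move=> pu0; exists (1 + pu^-1) => [|s us]; first by rewrite addr_gt0 ?invr_gt0.
have ipu : 0 < pu^-1 by rewrite invr_gt0.
have s1 : 1 <= s by lra.
apply: ge_ereal_sup => _ [m Xm <-]; apply: ge_ereal_sup => _ [S [spdS detS _] <-].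
apply: le_trans (psucc_le d_gt0 _ _ (Xab_fmu Xm) spdS detS) _.
- by case: HA1.
- lra.
rewrite lee_fin invf_ple ?posrE// ?exprn_gt0//; last by lra.
apply: (@le_trans _ _ s); first by lra.
by rewrite -[leLHS]expr1; apply: ler_weXn2l.
Qed.

End step_size_range.

(** * Measures given by a density *)

Section density_measure.
Local Open Scope ereal_scope.
Context {dT : measure_display} {T : measurableType dT} {R : realType}.
Variables (nu : {measure set T -> \bar R}) (g : T -> \bar R).
Hypotheses (mg : measurable_fun setT g) (g_ge0 : forall z, 0 <= g z).

(** The proofs of measurability and nonnegativity are arguments so that the measure structure can be
    attached to the function itself. *)
Definition density_measure of measurable_fun setT g & (forall z, 0 <= g z) :=
  fun D : set T => \int[nu]_(z in D) g z.

Local Notation dm := (density_measure mg g_ge0).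

Let density_measure0 : dm set0 = 0.
Proof. exact: integral_set0. Qed.

Let density_measure_ge0 D : 0 <= dm D.
Proof. by apply: integral_ge0 => z _. Qed.

Let density_measure_sigma_additive : semi_sigma_additive dm.
Proof. exact: semi_sigma_additive_nng_induced. Qed.

HB.instance Definition _ := isMeasure.Build _ _ _ dm
  density_measure0 density_measure_ge0 density_measure_sigma_additive.

End density_measure.

(** * Joint law of a state and a sample with conditional density *)

Section joint_law.
Local Open Scope ereal_scope.
Context {dO dT dU : measure_display} {O : measurableType dO}
  {T : measurableType dT} {U : measurableType dU} {R : realType}.
Variables (P : probability O R) (mu : {sigma_finite_measure set U -> \bar R}).
Variables (th : O -> T) (X : O -> U) (g : T * U -> R).
Hypotheses (mth : measurable_fun setT th) (mX : measurable_fun setT X).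
Hypotheses (mg : measurable_fun setT g) (g_ge0 : forall z, (0 <= g z)%R).

(** The conditional probability that the pair lies in [D] given the state [t], when [g (t, .)] is
    the conditional density of the sample. *)
Definition section_integral (D : set (T * U)) (t : T) : \bar R :=
  \int[mu]_(y in xsection D t) (g (t, y))%:E.

Let h (D : set (T * U)) : T * U -> \bar R := (EFin \o g) \_ D.

Let mh D : measurable D -> measurable_fun setT (h D).
Proof.
move=> mD; apply/(measurable_restrictT _ mD).
by apply: measurable_funTS; apply/measurable_EFinP.
Qed.

Let h0 D z : 0 <= h D z.
Proof. by rewrite /h patchE; case: ifP => // _; rewrite lee_fin. Qed.

Let section_integralE D : section_integral D = fubini_F mu (h D).
Proof.
apply/funext => t; rewrite /section_integral /fubini_F [LHS]integral_mkcond.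

apply: eq_integral => y _; rewrite /h !patchE; congr (if _ then _ else _).
by apply/idP/idP; rewrite !inE /xsection/= inE.
Qed.

Lemma measurable_section_integral D : measurable D ->
  measurable_fun setT (section_integral D).
Proof.
by move=> mD; rewrite section_integralE; apply: measurable_fun_fubini_tonelli_F => //; exact: mh.
Qed.

Lemma section_integral_ge0 D t : 0 <= section_integral D t.
Proof. by apply: integral_ge0 => y _; rewrite lee_fin. Qed.

Hypothesis law_rect : forall A B, measurable A -> measurable B ->
  P ((th @^-1` A) `&` (X @^-1` B)) =
  \int[P]_(w in th @^-1` A) \int[mu]_(y in B) (g (th w, y))%:E.

Let mth_mixin := isMeasurableFun.Build _ _ _ _ _ mth.
Let thm : {mfun O >-> T} := HB.pack th mth_mixin.

Let Pth : probability T R := distribution P thm.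

Let mthX : measurable_fun setT (fun w => (th w, X w)).
Proof. exact: measurable_fun_pair. Qed.

Let law1 : {measure set (T * U) -> \bar R} :=
  measure_function_pushforward__canonical__measure_function_Measure P mthX.

Let mgE : measurable_fun setT (EFin \o g).
Proof. exact/measurable_EFinP. Qed.

Let gE0 z : 0 <= (EFin \o g) z.
Proof. by rewrite lee_fin. Qed.

Let law2 : {measure set (T * U) -> \bar R} :=
  density_measure (Pth \x mu) mgE gE0.

Let law2E D : measurable D -> law2 D = \int[P]_w section_integral D (th w).
Proof.
move=> mD; rewrite /law2/= /density_measure [LHS]integral_mkcond.
rewrite -[LHS]/(\int[Pth \x mu]_z h D z) (fubini_tonelli1 _ (mh mD) (h0 D)).
rewrite -section_integralE.
transitivity (\int[Pth]_t section_integral D t); first by [].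
rewrite (ge0_integral_pushforward mth)//; first exact: measurable_section_integral.
by move=> t _; exact: section_integral_ge0.
Qed.

(** Both sides are measures in [D]: the pushforward of [P] by the pair, and the measure with density
    [g] with respect to the law of [th] times [mu]. They agree on rectangles, which generate the
    product sigma-algebra and are stable under intersection. *)
Lemma joint_lawE D : measurable D ->
  P [set w | D (th w, X w)] = \int[P]_w section_integral D (th w).
Proof.
move=> mD; rewrite -law2E// -[LHS]/(law1 D).
pose G : set (set (T * U)) :=
  [set A `*` B | A in measurable & B in measurable].
apply: (measure_unique G (fun=> setT)) => //.
- by rewrite measurable_prod_measurableType.
- move=> _ _ [A1 mA1 [B1 mB1 <-]] [A2 mA2 [B2 mB2 <-]].
  rewrite -setXI; exists (A1 `&` A2); first exact: measurableI.
  by exists (B1 `&` B2) => //; exact: measurableI.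
- by move=> _; exists setT => //; exists setT => //; rewrite setXTT.
- by rewrite bigcup_const//; exists 0%N.
- move=> _ [A mA [B mB <-]].
  rewrite [RHS]law2E; last exact: measurableX.
  rewrite -[LHS]/(P ((th @^-1` A) `&` (X @^-1` B))) law_rect// [LHS]integral_mkcond.
  apply: eq_integral => w _; rewrite patchE /section_integral.
  case: ifPn => [|]; rewrite ?inE ?notin_setE /= => Aw.
    by congr (integral _ _ _); apply/seteqP; split => y;
       rewrite /xsection/= inE//= => -[].
  rewrite (_ : xsection _ _ = set0) ?integral_set0//.
  by apply/seteqP; split => y //; rewrite /xsection/= inE/= => -[].
- by move=> _; rewrite -[X in X < _]/(P setT) probability_setT ltry.
Qed.

Let joint_lawIE D A : measurable D -> measurable A ->
  P (th @^-1` A `&` [set w | D (th w, X w)]) =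
  \int[P]_(w in th @^-1` A) section_integral D (th w).
Proof.
move=> mD mA; pose DA := D `&` (A `*` setT).
have mDA : measurable DA by apply: measurableI => //; exact: measurableX.
transitivity (P [set w | DA (th w, X w)]).
  by congr (P _); apply/seteqP; split => w /=; rewrite /DA/=; tauto.
rewrite joint_lawE// [RHS]integral_mkcond; apply: eq_integral => w _.
rewrite patchE /section_integral /DA.
case: ifPn => [|]; rewrite ?inE ?notin_setE /= => Aw.
  congr (integral _ _ _); apply/seteqP; split => y; rewrite /xsection/= !inE/=; tauto.
rewrite (_ : xsection _ _ = set0) ?integral_set0//.
apply/seteqP; split => y //; rewrite /xsection/= inE/=; tauto.
Qed.

Let mthA A : measurable A -> measurable (th @^-1` A).
Proof. by move=> mA; rewrite -[X in measurable X]setTI; exact: mth. Qed.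

Let msth A D : measurable D ->
  measurable_fun (th @^-1` A) (fun w => section_integral D (th w)).
Proof.
move=> mD; apply: measurable_funTS.
exact: (measurableT_comp (measurable_section_integral mD)).
Qed.

(** A bound on the conditional probability at every state of [A] integrates to a bound on the event;
    in this form conditional probabilities enter the drift estimate. *)
Lemma joint_law_ge D A (p : R) : measurable D -> measurable A -> (0 <= p)%R ->
  (forall w, A (th w) -> p%:E <= section_integral D (th w)) ->
  p%:E * P (th @^-1` A) <= P (th @^-1` A `&` [set w | D (th w, X w)]).
Proof.
move=> mD mA p0 pD; rewrite joint_lawIE// -integral_cst; last exact: mthA.
apply: ge0_le_integral => //; [exact: mthA|exact: msth].
Qed.

Lemma joint_law_le D A (p : R) : measurable D -> measurable A -> (0 <= p)%R ->
  (forall w, A (th w) -> section_integral D (th w) <= p%:E) ->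
  P (th @^-1` A `&` [set w | D (th w, X w)]) <= p%:E * P (th @^-1` A).
Proof.
move=> mD mA p0 pD; rewrite joint_lawIE// -integral_cst; last exact: mthA.
apply: ge0_le_integral => //; [exact: mthA| |exact: msth].
by move=> w _; exact: section_integral_ge0.
Qed.

End joint_law.

(** * One-step changes of the potential in logarithmic coordinates *)

Section drift.
Context {R : realType}.
Variables (v La Ld Ll Lu : R).
Hypotheses (v0 : 0 < v) (v1 : v < 1) (La0 : 0 < La) (Ld0 : 0 < Ld).
Hypothesis gap : La + Ld <= Lu - Ll.
Implicit Types (p q : R).

(* The potential in the coordinates p = ln (f_mu m), q = ln sigma; the constants
   are La = ln alpha_up, Ld = - ln alpha_down, Ll = ln l, Lu = ln u. *)
Definition log_potential p q : R :=
  p + Num.max 0 (Num.max (v * (La + Ll + p - q)) (v * (q + Ld - Lu - p))).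

Lemma log_potential_ge p q : p <= log_potential p q.
Proof. by rewrite lerDl le_max lexx. Qed.

Let le_log_potential p q (c : R) : p <= c -> p + v * (La + Ll + p - q) <= c ->
  p + v * (q + Ld - Lu - p) <= c -> log_potential p q <= c.
Proof.
move=> c1 c2 c3; rewrite /log_potential -lerBrDl !ge_max !lerBrDl addr0.
by rewrite c1 c2 c3.
Qed.

Let log_potential_ge1 p q : p + v * (La + Ll + p - q) <= log_potential p q.
Proof. by rewrite lerD2l !le_max lexx !orbT. Qed.

Let log_potential_ge2 p q : p + v * (q + Ld - Lu - p) <= log_potential p q.
Proof. by rewrite lerD2l !le_max lexx !orbT. Qed.

(** The drift bounds are linear apart from products with [v] and [1 - v]; these facts supply such
    products to [nra]. *)
Let vLa : 0 < v * La. Proof. exact: mulr_gt0. Qed.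
Let vLd : 0 < v * Ld. Proof. exact: mulr_gt0. Qed.
Let vgap : 0 <= v * (Lu - Ll - La - Ld).
Proof. by apply: mulr_ge0; [exact: ltW|move: gap; lra]. Qed.
Let vp p p' : p' <= p -> 0 <= (1 - v) * (p - p').
Proof. by move=> h; rewrite mulr_ge0 ?subr_ge0// ltW. Qed.
Let vp' p p' : p' <= p -> 0 <= v * (p - p').
Proof. by move=> h; rewrite mulr_ge0 ?subr_ge0// ltW. Qed.

(** The factor [alpha_up] in the potential makes the first penalty at least [v * La] on small steps,
    so it can fall by that full amount. By [gap] the other penalty becomes at most [v * (p - p')],
    which the decrease of [p] absorbs since [v < 1]. *)
Lemma drift_small_success p p' q : q - p <= Ll -> p' <= p ->
  log_potential p' (q + La) <= log_potential p q - v * La.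
Proof.
move=> h pp; have h1 := log_potential_ge1 p q.
have : 0 <= v * (Ll - (q - p)) by rewrite mulr_ge0 ?subr_ge0// ltW.
have := vp pp; have := vp' pp => *.
by apply: le_log_potential; move: vLa vLd vgap => *; nra.
Qed.

Lemma drift_small_failure p q : q - p <= Ll ->
  log_potential p (q - Ld) <= log_potential p q + v * Ld.
Proof.
move=> h; have h1 := log_potential_ge1 p q.
have : 0 <= v * (Ll - (q - p)) by rewrite mulr_ge0 ?subr_ge0// ltW.
move=> *.
by apply: le_log_potential; move: vLa vLd vgap => *; nra.
Qed.

(** Mirror image of [drift_small_success]: the factor [alpha_down] makes the second penalty at least
    [v * Ld], and a failure leaves [p] unchanged. *)
Lemma drift_large_failure p q : Lu <= q - p ->
  log_potential p (q - Ld) <= log_potential p q - v * Ld.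
Proof.
move=> h; have h1 := log_potential_ge2 p q.
have : 0 <= v * (q - p - Lu) by rewrite mulr_ge0 ?subr_ge0// ltW.
move=> *.
by apply: le_log_potential; move: vLa vLd vgap => *; nra.
Qed.

Lemma drift_success p p' q : Ll <= q - p -> p' <= p ->
  log_potential p' (q + La) <= log_potential p q + v * La.
Proof.
move=> h pp; have h1 := log_potential_ge2 p q; have h0 := log_potential_ge p q.
have : 0 <= v * (q - p - Ll) by rewrite mulr_ge0 ?subr_ge0// ltW.
have := vp pp; have := vp' pp => *.
by apply: le_log_potential; move: vLa vLd vgap => *; nra.
Qed.

Lemma drift_failure p q : q - p <= Lu ->
  log_potential p (q - Ld) <= log_potential p q + v * Ld.
Proof.
move=> h; have h1 := log_potential_ge1 p q; have h0 := log_potential_ge p q.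
have : 0 <= v * (Lu - (q - p)) by rewrite mulr_ge0 ?subr_ge0// ltW.
move=> *.
by apply: le_log_potential; move: vLa vLd vgap => *; nra.
Qed.

(** A loss in [p] raises the second penalty by up to [v] times that loss, so a loss of [A / (1 - v)]
    is needed to gain [A]. This is the origin of the constant [r]. *)
Lemma drift_progress A p p' q : 0 < A -> Ll <= q - p -> q - p <= Lu ->
  p' <= p - A / (1 - v) ->
  log_potential p' (q + La) <= log_potential p q - A + v * (La + Ld).
Proof.
move=> A0 h h' pp; have h0 := log_potential_ge p q.
have u0 : 0 < 1 - v by rewrite subr_gt0.
have pA : (1 - v) * p' <= (1 - v) * p - A.
  have := ler_wpM2l (ltW u0) pp; rewrite mulrBr => /le_trans; apply.
  by rewrite mulrCA mulfV ?gt_eqF// mulr1.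
have AA : A <= A / (1 - v) by rewrite ler_pdivlMr// ler_piMr ?(ltW A0)//; move: v0; lra.
have pp' : p' <= p by apply: le_trans pp _; lra.
have : 0 <= v * (q - p - Ll) by rewrite mulr_ge0 ?subr_ge0// ltW.
have : 0 <= v * (Lu - (q - p)) by rewrite mulr_ge0 ?subr_ge0// ltW.
have := vp' pp' => *.
by apply: le_log_potential; move: vLa vLd vgap => *; nra.
Qed.

End drift.

(** * Expectations of indicator sums and of hitting times *)

Section probability_bounds.
Context {dO : measure_display} {O : measurableType dO} {R : realType}.
Variable P : probability O R.

(** Integrability and value are proved together because the induction step needs both. *)
Let sum_indic_integral (I : Type) (L : seq I) (c : I -> R) (E : I -> set O) (K : R) :
  (forall i, measurable (E i)) ->
  P.-integrable setT (EFin \o (fun w => K + \sum_(i <- L) c i * \1_(E i) w)) /\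
  (\int[P]_w (K + \sum_(i <- L) c i * \1_(E i) w)%:E =
   (K + \sum_(i <- L) c i * fine (P (E i)))%:E)%E.
Proof.
move=> mE; elim: L => [|i L [IH1 IH2]].
  rewrite !big_nil addr0; split.
    under eq_fun do rewrite big_nil addr0.
    exact: finite_measure_integrable_cst.
  under eq_integral do rewrite big_nil addr0.
  rewrite integral_cst// [X in (_ * X)%E](_ : _ = 1%E) ?mule1//.
  exact: probability_setT.
have ind : P.-integrable setT (EFin \o (fun w => c i * \1_(E i) w)).
  rewrite (_ : _ \o _ = fun w => (c i)%:E * (\1_(E i) w)%:E)%E; last first.
    by apply/funext => w; rewrite /= EFinM.
  apply: integrableZl => //; exact: integrable_indic.
have sumE w : K + \sum_(j <- i :: L) c j * \1_(E j) w =
    c i * \1_(E i) w + (K + \sum_(j <- L) c j * \1_(E j) w).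
  by rewrite big_cons addrCA.
split.
  under eq_fun do rewrite sumE.
  rewrite (_ : _ \o _ = (EFin \o (fun w => c i * \1_(E i) w)%R) \+
    (EFin \o (fun w => K + \sum_(i <- L) c i * \1_(E i) w)%R))%E//.
  exact: integrableD.
under eq_integral do rewrite sumE EFinD.
rewrite integralD// IH2 big_cons addrCA [RHS]EFinD.
congr (_ + _)%E.
under eq_integral do rewrite EFinM.
rewrite integralZl//; last exact: integrable_indic.
by rewrite integral_indic// setIT EFinM fineK// fin_num_measure.
Qed.

(** Takes expectations in a pointwise inequality for a finite combination of indicators, the form to
    which the drift argument is reduced. *)
Lemma sum_indic_ge0 (I : Type) (L : seq I) (c : I -> R) (E : I -> set O) (K : R) :
  (forall i, measurable (E i)) ->
  (forall w, 0 <= K + \sum_(i <- L) c i * \1_(E i) w) ->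
  0 <= K + \sum_(i <- L) c i * fine (P (E i)).
Proof.
move=> mE pos; rewrite -lee_fin -(sum_indic_integral L c K mE).2.
by apply: integral_ge0 => w _; rewrite lee_fin.
Qed.

(** Read off the definition of the integral as a supremum over simple functions, so that it covers
    hitting times of arbitrary predicates [Q]. *)
Let ge0_le_integral_setT (g h : O -> \bar R) : (forall w, 0 <= g w)%E ->
  (forall w, g w <= h w)%E -> (\int[P]_w g w <= \int[P]_w h w)%E.
Proof.
move=> g0 gh; have h0 w : (0 <= h w)%E by exact: le_trans (gh w).
rewrite !ge0_integralTE//; apply: le_ereal_sup => _ [k kg <-]; exists k => // w.
exact: le_trans (gh w).
Qed.

(** Every [E t] holds before [Q] first does, so the hitting time is at most the sum of the
    indicators of the [E t], which is integrated term by term. *)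
Lemma hitting_time_bound (Q : nat -> O -> Prop) (E : nat -> set O) (K : R) :
  (forall t, measurable (E t)) ->
  (forall t w, (forall s, (s <= t)%N -> ~ Q s w) -> E t w) ->
  (forall n, \sum_(t < n) fine (P (E t)) <= K) ->
  (\int[P]_w hitting_time (fun t => Q t w) <= K%:E)%E.
Proof.
move=> mE QE PK.
have sum_ge w n : (forall s, (s < n)%N -> ~ Q s w) ->
    (n%:R%:E <= \sum_(t <oo) (\1_(E t) w)%:E :> \bar R)%E.
  move=> nQ; apply: (@le_trans _ _ (\sum_(0 <= t < n) (\1_(E t) w)%:E)%E).
    rewrite (eq_big_nat _ _ (F2 := fun=> 1%:E)); last first.
      move=> t /andP[_ tn]; rewrite indicE mem_set//; apply: QE => s st.
      by apply: nQ; exact: leq_ltn_trans tn.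
    by rewrite sumEFin lee_fin big_const_nat iter_addr subn0 addr0.
  exact: nneseries_lim_ge.
apply: (@le_trans _ _ (\int[P]_w (\sum_(t <oo) (\1_(E t) w)%:E))%E).
  apply: ge0_le_integral_setT => w.
    by apply: le_ereal_inf_tmp => _ [t _ <-]; rewrite lee_fin.
  have [[t Qt]|nQ] := pselect (exists t, Q t w).
    have exQ : exists t, `[< Q t w >] by exists t; apply/asboolP.
    case: (ex_minnP exQ) => t0 /asboolP Qt0 t0min.
    apply: le_trans (sum_ge w t0 _); first by apply: ereal_inf_lbound; exists t0.
    by move=> s st Qs; move: (t0min s (asboolT Qs)); rewrite leqNgt st.
  (* If [Q] never holds, the series exceeds every natural number. *)
  rewrite [leRHS](_ : _ = +oo%E) ?leey//; apply/eqyP => r r0.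
  apply: le_trans (sum_ge w (Num.truncn r).+1 _).
    by rewrite lee_fin; exact/ltW/truncnS_gt.
  by move=> s _ Qs; apply: nQ; exists s.
rewrite integral_nneseries//; last first.
  by move=> t; apply/measurable_EFinP; exact: measurable_indic.
apply: lime_le; first by apply: is_cvg_nneseries => t _ _; exact: integral_ge0.
apply: nearW => n; rewrite big_mkord.
rewrite (eq_bigr (fun t : 'I_n => (fine (P (E t)))%:E)); last first.
  by move=> t _; rewrite integral_indic// setIT fineK// fin_num_measure.
by rewrite sumEFin lee_fin; exact: PK.
Qed.

End probability_bounds.

(** * From suboptimality to distance to the minimizer *)

Section distance_to_minimizer.
Context {R : realType} {d : nat}.
Implicit Types (x y : 'rV[R]_d) (r : R).

Let sqnormE x : (x *m x^T) 0 0 = \sum_i x 0 i ^+ 2.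
Proof. by rewrite mxE; apply: eq_bigr => i _; rewrite mxE expr2. Qed.

Lemma enorm_le_sqr x r : 0 <= r -> enorm x <= r -> (x *m x^T) 0 0 <= r ^+ 2.
Proof.
move=> r0 xr; rewrite -[leLHS]sqr_sqrtr; first by rewrite lerXn2r ?nnegrE ?sqrtr_ge0.
by rewrite sqnormE sumr_ge0// => i _; rewrite sqr_ge0.
Qed.

(** Sums the coordinatewise inequality [(s - t)^2 <= 2 s^2 + 2 t^2] for the differences to the
    center [c]. *)
Lemma enorm_sub_le c x y r : 0 <= r -> enorm (x - c) <= r -> enorm (y - c) <= r ->
  enorm (x - y) <= 2 * r.
Proof.
move=> r0 /(enorm_le_sqr r0) xr /(enorm_le_sqr r0) yr.
rewrite -[leRHS]ger0_norm ?mulr_ge0// -sqrtr_sqr ler_wsqrtr//.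
apply: (@le_trans _ _ (2 * ((x - c) *m (x - c)^T) 0 0 + 2 * ((y - c) *m (y - c)^T) 0 0)).
  rewrite !sqnormE !mulr_sumr -big_split/= ler_sum// => i _; rewrite !mxE.
  by have := sqr_ge0 (x 0 i - c 0 i + (y 0 i - c 0 i)); nra.
by rewrite exprMn; lra.
Qed.

Variables (f : 'rV[R]_d -> R) (a : R) (b : \bar R) (Cl Cu : R).
Hypotheses (a_ge0 : 0 <= a) (HA1 : A1 f a b Cl Cu).

(** Both [y] and the minimizer lie in the outer ball of [m], whose diameter is at most
    [2 * Cu * c]. *)
Let A1_dist m y xs c : Xab f a b m -> (fmu f y <= fmu f m)%E ->
  (forall z, f xs <= f z) -> (fmu f m <= c%:E)%E -> enorm (y - xs) <= 2 * Cu * c.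
Proof.
case: HA1 => _ _ Cu0 balls Xm ym xsmin mc.
have [_ [cu [_ usub]]] := balls m Xm.
have c0 : 0 <= c by rewrite -lee_fin (le_trans (fmu_ge0 f m)).
have Cuc z : (fmu f z <= fmu f m)%E -> enorm (z - cu) <= Cu * c.
  move=> /usub/= zm; rewrite -lee_fin EFinM (le_trans zm)//.
  by rewrite lee_pmul2l// lte_fin.
rewrite -mulrA; apply: (enorm_sub_le (c := cu)); [|exact: Cuc|apply: Cuc].
  by rewrite mulr_ge0// ltW.
by apply: le_trans ym; apply: le_fmu => //; case: HA1.
Qed.

(** If [fmu y > a], then [A1] applies at [y] itself. Otherwise [0 < a], and [level_reached] provides
    points of [Xab] with [fmu] below any number greater than [eps]; their outer balls contain [y],
    and the excess tends to 0. *)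
Lemma sublevel_near_minimizer y xs eps : (fmu f y <= eps%:E)%E -> (fmu f y <= b)%E ->
  (0 < fmu f y)%E -> (forall z, f xs <= f z) -> level_reached f a b eps ->
  enorm (y - xs) <= 2 * Cu * eps.
Proof.
move=> yeps yb y0 xsmin lev; have [ay|ya] := ltP a%:E (fmu f y).
  by apply: (A1_dist _ (lexx _)) => //; apply/andP.
have a0 : 0 < a by rewrite -lte_fin (lt_le_trans y0).
have Cu0 : 0 < Cu by case: HA1.
apply/ler_addgt0Pr => e e0.
(* Scaled so that the excess over [eps] adds exactly [e] to the distance bound. *)
have e20 : 0 < e / (2 * Cu) by rewrite divr_gt0// mulr_gt0.
have : (ereal_inf [set fmu f m | m in Xab f a b] < (eps + e / (2 * Cu))%:E)%E.
  by rewrite (le_lt_trans (lev a0))// lte_fin ltrDl.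
move=> /ereal_inf_lt[_ [m Xm <-] me].
rewrite [leRHS](_ : _ = 2 * Cu * (eps + e / (2 * Cu))); last first.
  by field; rewrite gt_eqF.
apply: (A1_dist Xm) => //; last exact: ltW.
by case/andP: Xm => am _; rewrite (le_trans ya)// ltW.
Qed.

End distance_to_minimizer.

(** * Invariants and conditional law of a run *)

Section run_law.
Context {R : realType} {d : nat}.
Variables (kappa au ad : R) (f : 'rV[R]_d -> R).
Variables (m0 : 'rV[R]_d) (s0 : R) (S0 : 'M[R]_d).
Context {dO : measure_display} {O : measurableType dO} (P : probability O R).
Variables (m : nat -> {RV P >-> 'rV[R]_d}) (sg : nat -> {RV P >-> R})
    (Sig : nat -> {RV P >-> 'M[R]_d}) (x : nat -> {RV P >-> 'rV[R]_d})
    (E : Type) (rule : @cov_rule R d E) (seed : nat -> O -> E).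
Hypotheses (d_gt0 : (0 < d)%N) (mf : measurable_fun setT f).
Hypotheses (au1 : 1 < au) (ad01 : 0 < ad < 1).
Hypotheses (s00 : 0 < s0) (S0k : Skappa kappa S0).
Hypothesis run : es_run m sg Sig x kappa au ad f m0 s0 S0 rule seed.

Lemma run_init w : [/\ m 0%N w = m0, sg 0%N w = s0 & Sig 0%N w = S0].
Proof. by have := es_init run w => -[]. Qed.

Lemma run_sigma_gt0 t w : 0 < sg t w.
Proof.
elim: t => [|t IH]; first by have [_ -> _] := run_init w.
have [fx|fx] := leP (f (x t w)) (f (m t w)).
  have [_ ->] := es_success run fx.
  by rewrite mulr_gt0// (lt_trans ltr01).
by have [_ ->] := es_failure run fx; rewrite mulr_gt0//; case/andP: ad01.
Qed.

Lemma run_Skappa t w : Skappa kappa (Sig t w).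
Proof.
case: t => [|t]; first by have [_ _ ->] := run_init w.
by rewrite (es_cov run); exact: (es_rule_Skappa run).
Qed.

Lemma run_unitmx t w : Sig t w \in unitmx.
Proof. by have [_ detS _] := run_Skappa t w; rewrite unitmxE detS unitr1. Qed.

Lemma run_f_le t w : f (m t.+1 w) <= f (m t w).
Proof.
have [fx|fx] := leP (f (x t w)) (f (m t w)); first by have [-> _] := es_success run fx.
by have [-> _] := es_failure run fx.
Qed.

Lemma run_fmu_le t w : (fmu f (m t.+1 w) <= fmu f (m t w))%E.
Proof. by apply: le_fmu => //; exact: run_f_le. Qed.

Lemma run_fmu_le0 t w : (fmu f (m t w) <= fmu f m0)%E.
Proof.
elim: t => [|t]; first by have [-> _ _] := run_init w.
exact: le_trans (run_fmu_le t w).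
Qed.

Local Notation th := (theta m sg Sig).
Local Notation stateT := ('rV[R]_d * R * 'M[R]_d)%type.

Lemma measurable_theta t : measurable_fun setT (th t).
Proof. by do 2 (apply: measurable_fun_pair => //). Qed.

Let g (z : stateT * 'rV[R]_d) : R := gauss_pdf z.1.1.1 (z.1.1.2 ^+ 2 *: z.1.2) z.2.

Let m_fst : measurable_fun setT (fun z : stateT * 'rV[R]_d => z.1.1.1).
Proof. exact: (measurableT_comp measurable_fst (measurableT_comp measurable_fst measurable_fst)). Qed.

Let mg : measurable_fun setT g.
Proof.
apply: measurable_gauss_pdf => //.
apply: measurable_scalemx; last exact: (measurableT_comp measurable_snd measurable_fst).
apply: measurable_funX.
exact: (measurableT_comp measurable_snd (measurableT_comp measurable_fst measurable_fst)).
Qed.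

Let g_ge0 z : 0 <= g z.
Proof. exact: gauss_pdf_ge0. Qed.

(** Preimages under [theta t] belong to the natural filtration at time [t], so [es_sample] applies
    to them. *)
Let law_rect t (A : set stateT) (B : set 'rV[R]_d) : measurable A -> measurable B ->
  (P ((th t @^-1` A) `&` (x t @^-1` B)) =
   \int[P]_(w in th t @^-1` A) \int[lebesgue_rV d]_(y in B) (g (th t w, y))%:E)%E.
Proof.
move=> mA mB; rewrite (es_sample run)//.
apply: sub_sigma_algebra; exists t => //=; exists A => //.
by rewrite setTI.
Qed.

Lemma run_law_ge t (D : set (stateT * 'rV[R]_d)) (A : set stateT) (p : R) :
  measurable D -> measurable A -> 0 <= p ->
  (forall w, A (th t w) -> (p%:E <=
     gauss (m t w) (sg t w ^+ 2 *: Sig t w) (xsection D (th t w)))%E) ->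
  (p%:E * P (th t @^-1` A) <= P (th t @^-1` A `&` [set w | D (th t w, x t w)]))%E.
Proof.
move=> mD mA p0 pD.
exact: (joint_law_ge (measurable_theta t) (measurable_funPT (x t)) mg g_ge0
  (@law_rect t)).
Qed.

Lemma run_law_le t (D : set (stateT * 'rV[R]_d)) (A : set stateT) (p : R) :
  measurable D -> measurable A -> 0 <= p ->
  (forall w, A (th t w) ->
     (gauss (m t w) (sg t w ^+ 2 *: Sig t w) (xsection D (th t w)) <= p%:E)%E) ->
  (P (th t @^-1` A `&` [set w | D (th t w, x t w)]) <= p%:E * P (th t @^-1` A))%E.
Proof.
move=> mD mA p0 pD.
exact: (joint_law_le (measurable_theta t) (measurable_funPT (x t)) mg g_ge0
  (@law_rect t)).
Qed.

Lemma measurable_run_fmu_le t (c : \bar R) : measurable [set w | (fmu f (m t w) <= c)%E].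
Proof.
rewrite (_ : [set _ | _] = setT `&` m t @^-1` [set y | (fmu f y <= c)%E]); last first.
  by rewrite setTI.
by apply: measurable_funPT => //; exact: measurable_fmu_le.
Qed.

(* The mean never hits the null set where [fmu] vanishes, the Gaussian being
   absolutely continuous. *)
Lemma run_fmu_gt0 t : (0 < fmu f m0)%E -> P [set w | (fmu f (m t w) <= 0)%E] = 0%E.
Proof.
move=> m00; elim: t => [|t IH].
  rewrite (_ : [set _ | _] = set0) ?measure0//; apply/seteqP; split => w //=.
  by have [-> _ _] := run_init w; rewrite leNgt m00.
pose D : set (stateT * 'rV[R]_d) := [set z | (fmu f z.2 <= 0)%E].
have mZ := measurable_fmu_le mf 0%E.
have mD : measurable D.
  rewrite (_ : D = setT `&` snd @^-1` [set y | (fmu f y <= 0)%E]) ?setTI//.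
  by rewrite -[X in measurable X]setTI; exact: measurable_snd.
(* The bound [run_law_le] with [p = 0]: from every state the Gaussian gives the null set probability
   0. *)
have xnull : P (x t @^-1` [set y | (fmu f y <= 0)%E]) = 0%E.
  have := @run_law_le t D setT 0 mD measurableT (lexx _).
  rewrite mul0e => h; apply/eqP; rewrite eq_le measure_ge0 andbT.
  rewrite (_ : _ @^-1` _ = th t @^-1` setT `&` [set w | D (th t w, x t w)]); last first.
    by apply/seteqP; split => w /=; [split|case].
  apply: h => w _.
  rewrite (_ : xsection _ _ = [set y | (fmu f y <= 0)%E]); last first.
    by apply/seteqP; split => y; rewrite /xsection/= inE.
  by rewrite gauss_null//; exact: lebesgue_fmu_eq0.
apply/eqP; rewrite eq_le measure_ge0 andbT.
have mx : measurable (x t @^-1` [set y | (fmu f y <= 0)%E]).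
  by rewrite -[X in measurable X]setTI; exact: (measurable_funPT (x t)).
(* The next mean is either the current mean or the sample. *)
apply: (@le_trans _ _ (P ([set w | (fmu f (m t w) <= 0)%E] `|`
   x t @^-1` [set y | (fmu f y <= 0)%E]))).
  apply: le_measure; rewrite ?inE; [exact: measurable_run_fmu_le| |].
    by apply: measurableU => //; exact: measurable_run_fmu_le.
  move=> w /=; have [fx|fx] := leP (f (x t w)) (f (m t w)).
    by have [-> _] := es_success run fx => ?; right.
  by have [-> _] := es_failure run fx => ?; left.
apply: le_trans (measureU2 _ _ _) _ => //; first exact: measurable_run_fmu_le.
by rewrite [X in (X + _)%E]IH [X in (_ + X)%E]xnull adde0.
Qed.

End run_law.

(** * The drift argument for the hitting times *)

Section expected_hitting_time.
Context {R : realType} {d : nat}.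
Variables (kappa au ad : R) (f : 'rV[R]_d -> R).
Variables (a : R) (b : \bar R) (Cl Cu : R) (m0 : 'rV[R]_d) (s0 : R) (S0 : 'M[R]_d).
Context {dO : measure_display} {O : measurableType dO} (P : probability O R).
Variables (m : nat -> {RV P >-> 'rV[R]_d}) (sg : nat -> {RV P >-> R})
    (Sig : nat -> {RV P >-> 'M[R]_d}) (x : nat -> {RV P >-> 'rV[R]_d})
    (E : Type) (rule : @cov_rule R d E) (seed : nat -> O -> E).
Variables (pl pu l u A v eps : R).
Hypotheses (d_gt0 : (0 < d)%N) (au1 : 1 < au) (ad01 : 0 < ad < 1).
Hypotheses (a_ge0 : 0 <= a) (HA1 : A1 f a b Cl Cu) (Xm0 : Xab f a b m0).
Hypotheses (s00 : 0 < s0) (S0k : Skappa kappa S0).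
Hypothesis run : es_run m sg Sig x kappa au ad f m0 s0 S0 rule seed.
Hypotheses (l0 : 0 < l) (u0 : 0 < u) (lu : au / ad <= u / l).
Hypothesis Hl : forall s, 0 < s -> s <= l -> (pl%:E <= plower f kappa a b s)%E.
Hypothesis Hu : forall s, u <= s -> (pupper f kappa a b s <= pu%:E)%E.
Hypotheses (pl0 : 0 <= pl) (pu0 : 0 <= pu) (plu : pl + pu = 2 * ptarget au ad).
Hypotheses (A0 : 0 < A) (v0 : 0 < v) (v1 : v < 1).
Hypotheses (vAd : v * ln (1 / ad) <= A) (vAu : v * ln au <= A).
Hypotheses (eps0 : 0 < eps) (aeps : a <= eps) (epsm0 : (eps%:E < fmu f m0)%E).

Let r := 1 - expR (- (A / (1 - v))).
Let pst := fine (pstar f kappa a b l u r).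
Variable B : R.
Hypotheses (B0 : 0 < B) (BA : B <= A * pst - v * ln (au / ad))
  (Bp : B <= v * ((pl - pu) / 2) * ln (au / ad)).

Let mf : measurable_fun setT f. Proof. by case: HA1. Qed.
Let ad0 : 0 < ad. Proof. by case/andP: ad01. Qed.
Let au0 : 0 < au. Proof. exact: lt_trans au1. Qed.

Let La := ln au.
Let Ld := ln (1 / ad).
Let La0 : 0 < La. Proof. exact: ln_gt0. Qed.
Let LdE : Ld = - ln ad. Proof. by rewrite /Ld div1r lnV ?posrE. Qed.
Let Ld0 : 0 < Ld.
Proof. by rewrite LdE oppr_gt0; apply: ln_lt0. Qed.
Let LadE : ln (au / ad) = La + Ld.
Proof. by rewrite ln_div ?posrE// LdE. Qed.

Let gap : La + Ld <= ln u - ln l.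
Proof.
by rewrite -LadE -ln_div ?posrE// ler_ln ?posrE ?divr_gt0.
Qed.

Let lltu : l < u.
Proof.
have : 1 < u / l.
  apply: lt_le_trans lu; rewrite ltr_pdivlMr// mul1r.
  by case/andP: ad01 => _ /lt_trans; apply.
by rewrite ltr_pdivlMr// mul1r.
Qed.

(** Follows from [0 < B <= A * pst - v * ln (au / ad)]; it later shows that [pstar] is finite. *)
Let pst0 : 0 < pst.
Proof.
rewrite -(pmulr_rgt0 _ A0); have : 0 < v * ln (au / ad).
  by rewrite LadE mulr_gt0// addr_gt0.
by move: BA B0; lra.
Qed.

Let pt_gap : (La + Ld) * (pl - ptarget au ad) = (pl - pu) / 2 * (La + Ld).
Proof. by rewrite mulrC; congr (_ * _); move: plu; lra. Qed.

(** At success probability [ptarget] the expected change of [ln sigma] is zero. *)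
Let ptE : (La + Ld) * ptarget au ad = Ld.
Proof.
rewrite /ptarget -/Ld LadE mulrCA mulfV ?mulr1//.
by rewrite gt_eqF// addr_gt0.
Qed.

Let phi t w : R := fine (fmu f (m t w)).
Let th := theta m sg Sig.
Let G t : set O := [set w | (eps%:E < fmu f (m t w))%E].

Let fmu0_fin : (0 < fmu f m0 < +oo)%E. Proof. exact: Xab_fmu HA1 _ Xm0. Qed.

Let fmu_fin t w : fmu f (m t w) \is a fin_num.
Proof.
rewrite ge0_fin_numE ?fmu_ge0//; case/andP: fmu0_fin => _; apply: le_lt_trans.
exact: (run_fmu_le0 mf run).
Qed.

Let phiE t w : fmu f (m t w) = (phi t w)%:E.
Proof. by rewrite fineK. Qed.

Let G_phi t w : G t w = (eps < phi t w) :> Prop.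
Proof. by rewrite /G/= phiE lte_fin. Qed.

Let G_Xab t w : G t w -> Xab f a b (m t w).
Proof.
move=> Gw; apply/andP; split; first by rewrite (le_lt_trans _ Gw)// lee_fin.
by rewrite (le_trans (run_fmu_le0 mf run t w))//; case/andP: Xm0.
Qed.

Let phi_le t w : phi t.+1 w <= phi t w.
Proof. by rewrite -lee_fin -!phiE; exact: (run_fmu_le mf run). Qed.

Let G_pred t w : G t.+1 w -> G t w.
Proof. by rewrite !G_phi => /lt_le_trans; apply; exact: phi_le. Qed.

Let sg_gt0 t w : 0 < sg t w. Proof. exact: (run_sigma_gt0 au1 ad01 s00 run). Qed.

(** * Step-size classes and their success probabilities *)

Local Notation stateT := ('rV[R]_d * R * 'M[R]_d)%type.

(** [AL], [AU] and [AM] split [AG] into small, large and intermediate normalized step sizes. They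
    are subsets of the whole state space, where [fmu] may be infinite, hence the extended-real
    comparisons. *)
Let AG : set stateT := [set z | (eps%:E < fmu f z.1.1)%E].
Let AL : set stateT := AG `&` [set z | (z.1.2%:E < l%:E * fmu f z.1.1)%E].
Let AU : set stateT := AG `&` [set z | (u%:E * fmu f z.1.1 < z.1.2%:E)%E].
Let AM : set stateT := AG `&` ~` [set z | (z.1.2%:E < l%:E * fmu f z.1.1)%E]
   `&` ~` [set z | (u%:E * fmu f z.1.1 < z.1.2%:E)%E].

Let mst : measurable_fun setT (fun z : stateT => fmu f z.1.1).
Proof.
exact: (measurableT_comp (measurable_fmu mf) (measurableT_comp measurable_fst measurable_fst)).
Qed.

Let msig : measurable_fun setT (fun z : stateT => z.1.2%:E).
Proof.
by apply/measurable_EFinP; exact: (measurableT_comp measurable_snd measurable_fst).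
Qed.

Let measurable_ltT (T : stateT -> \bar R) (T' : stateT -> \bar R) :
  measurable_fun setT T -> measurable_fun setT T' -> measurable [set z | (T z < T' z)%E].
Proof. by move=> mT mT'; rewrite -[X in measurable X]setTI; exact: measurable_lte. Qed.

Let mlow : measurable [set z : stateT | (z.1.2%:E < l%:E * fmu f z.1.1)%E].
Proof. by apply: measurable_ltT => //; exact: measurable_funeM. Qed.
Let mup : measurable [set z : stateT | (u%:E * fmu f z.1.1 < z.1.2%:E)%E].
Proof. by apply: measurable_ltT => //; exact: measurable_funeM. Qed.
Let mAG : measurable AG. Proof. exact: measurable_ltT. Qed.
Let mAL : measurable AL. Proof. exact: measurableI. Qed.
Let mAU : measurable AU. Proof. exact: measurableI. Qed.
Let mAM : measurable AM.
Proof. by do !apply: measurableI => //; exact: measurableC. Qed.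

Let DS : set (stateT * 'rV[R]_d) := [set z | f z.2 <= f z.1.1.1].
Let DR : set (stateT * 'rV[R]_d) := [set z | Sr f r z.1.1.1 z.2].

Let m_fst : measurable_fun setT (fun z : stateT * 'rV[R]_d => z.1.1.1).
Proof.
exact: (measurableT_comp measurable_fst (measurableT_comp measurable_fst measurable_fst)).
Qed.

Let mDS : measurable DS.
Proof.
rewrite (_ : DS = setT `&` [set z | ((f z.2)%:E <= (f z.1.1.1)%:E)%E]); last first.
  by rewrite setTI; apply/seteqP; split => z; rewrite /DS/= lee_fin.
apply: measurable_lee => //; apply/measurable_EFinP.
  exact: (measurableT_comp mf measurable_snd).
exact: (measurableT_comp mf m_fst).
Qed.

Let mDR : measurable DR.
Proof.
rewrite -[X in measurable X]setTI; apply: measurable_lee => //.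
  exact: (measurableT_comp (measurable_fmu mf) measurable_snd).
by apply: measurable_funeM; exact: (measurableT_comp (measurable_fmu mf) m_fst).
Qed.

Let succ t : set O := [set w | f (x t w) <= f (m t w)].
Let prog t : set O := [set w | Sr f r (m t w) (x t w)].

Let phi_gt0 t w : G t w -> 0 < phi t w.
Proof. by rewrite G_phi; exact: lt_trans. Qed.

Let gauss_succE t w : G t w ->
  gauss (m t w) (sg t w ^+ 2 *: Sig t w) (xsection DS (th t w)) =
  psucc f 0 (sg t w / phi t w) (m t w) (Sig t w).
Proof.
move=> Gw; rewrite psuccE//; [|exact: Xab_fmu HA1 _ (G_Xab Gw)|exact: (run_unitmx S0k run)].
rewrite gauss_Sr0//; congr gauss.
by apply/seteqP; split => y; rewrite /xsection/= inE.
Qed.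

Let gauss_progE t w : G t w ->
  gauss (m t w) (sg t w ^+ 2 *: Sig t w) (xsection DR (th t w)) =
  psucc f r (sg t w / phi t w) (m t w) (Sig t w).
Proof.
move=> Gw; rewrite psuccE//; [|exact: Xab_fmu HA1 _ (G_Xab Gw)|exact: (run_unitmx S0k run)].
by congr gauss; apply/seteqP; split => y; rewrite /xsection/= inE.
Qed.

Let Sk t w : Skappa kappa (Sig t w). Proof. exact: (run_Skappa S0k run). Qed.

Let small_succ t :
  (pl%:E * P (th t @^-1` AL) <= P (th t @^-1` AL `&` succ t))%E.
Proof.
apply: (run_law_ge run mDS mAL pl0) => w [Gw sl].
rewrite gauss_succE//; move: sl; rewrite /= phiE -EFinM lte_fin => sl.
apply: le_trans (Hl (s := sg t w / phi t w) _ _) _.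
- by rewrite divr_gt0// phi_gt0.
- by rewrite ler_pdivrMr ?phi_gt0// ltW.
- apply: le_trans (ereal_inf_lbound _) _; first by exists (m t w); first exact: G_Xab.
  by apply: ereal_inf_lbound; exists (Sig t w) => //; exact: Sk.
Qed.

Let large_succ t :
  (P (th t @^-1` AU `&` succ t) <= pu%:E * P (th t @^-1` AU))%E.
Proof.
apply: (run_law_le run mDS mAU pu0) => w [Gw us].
rewrite gauss_succE//; move: us; rewrite /= phiE -EFinM lte_fin => us.
apply: le_trans _ (Hu (s := sg t w / phi t w) _).
- apply: le_trans (ereal_sup_ubound _); last by exists (m t w); first exact: G_Xab.
  by apply: ereal_sup_ubound; exists (Sig t w) => //; exact: Sk.
- by rewrite ler_pdivlMr ?phi_gt0// ltW.
Qed.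

Let middle_prog t :
  (pst%:E * P (th t @^-1` AM) <= P (th t @^-1` AM `&` prog t))%E.
Proof.
apply: (run_law_ge run mDR mAM (ltW pst0)) => w [[Gw /negP ls] /negP su].
rewrite gauss_progE//; move: ls su; rewrite /= phiE -!EFinM !lte_fin -!leNgt => ls su.
(* [fine] sends infinite values to 0, so [pst0] forces [pstar] to be finite. *)
have pstE : pst%:E = pstar f kappa a b l u r.
  by rewrite fineK//; move: pst0; rewrite /pst; case: pstar; rewrite //= ltxx.
rewrite pstE.
apply: le_trans (ereal_inf_lbound _) _.
  exists (sg t w / phi t w) => //=; rewrite in_itv/=.
  by rewrite ler_pdivlMr ?phi_gt0// ler_pdivrMr ?phi_gt0// ls su.
apply: le_trans (ereal_inf_lbound _) _; first by exists (m t w); first exact: G_Xab.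
by apply: ereal_inf_lbound; exists (Sig t w) => //; exact: Sk.
Qed.

(* [incr t] dominates the one-step change of the potential, truncated at [- A]:
   on small, large and intermediate step sizes it only depends on whether the
   offspring is accepted, accepted, or in [S_r]. *)
Let coef (k : nat) : R := nth 0
  [:: v * Ld; - (v * (La + Ld)); - (v * Ld); v * (La + Ld); v * (La + Ld); - A] k.
Let ev (t k : nat) : set O := nth set0
  [:: th t @^-1` AL; th t @^-1` AL `&` succ t; th t @^-1` AU;
      th t @^-1` AU `&` succ t; th t @^-1` AM; th t @^-1` AM `&` prog t] k.
Let incr t w : R := \sum_(k <- iota 0 6) coef k * \1_(ev t k) w.

Let mth A' t : measurable A' -> measurable (th t @^-1` A').
Proof.
by move=> mA'; rewrite -[X in measurable X]setTI; exact: (measurable_theta m sg Sig t).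
Qed.

Let mthx D t : measurable D -> measurable [set w | D (th t w, x t w)].
Proof.
move=> mD; rewrite -[X in measurable X]setTI.
have := measurable_fun_pair (measurable_theta m sg Sig t) (measurable_funPT (x t)).
by move=> /(_ measurableT D mD).
Qed.

Let msucc t : measurable (succ t). Proof. exact: (mthx t mDS). Qed.
Let mprog t : measurable (prog t). Proof. exact: (mthx t mDR). Qed.

Let mev t k : measurable (ev t k).
Proof.
case: k => [|[|[|[|[|[|k]]]]]]; rewrite /ev/= ?nth_nil//.
- exact: mth.
- by apply: measurableI => //; exact: mth.
- exact: mth.
- by apply: measurableI => //; exact: mth.
- exact: mth.
- by apply: measurableI => //; exact: mth.
Qed.

(** The coefficients come in pairs: the value when the second event of the pair fails, then the
    correction when it occurs, as in [v * Ld - v * (La + Ld) = - (v * La)] for small steps. *)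
Let incrE t w (L := w \in th t @^-1` AL) (U := w \in th t @^-1` AU)
    (M := w \in th t @^-1` AM) (c := v * (La + Ld)) :
  incr t w = v * Ld * L%:R + (- c * (L && (w \in succ t))%:R +
   (- (v * Ld) * U%:R + (c * (U && (w \in succ t))%:R +
   (c * M%:R + (- A * (M && (w \in prog t))%:R + 0))))).
Proof. by rewrite /incr !big_cons big_nil /L /U /M -!in_setI -!indicE. Qed.

Let incr_small t w : G t w -> sg t w < l * phi t w ->
  incr t w = if f (x t w) <= f (m t w) then - (v * La) else v * Ld.
Proof.
move=> Gw sl; have phi0 := phi_gt0 Gw.
have nsu : (u * phi t w < sg t w) = false.
  by apply/negbTE; rewrite -leNgt (le_trans (ltW sl))// ler_pM2r// ltW.
have ALw : (th t @^-1` AL) w by split => //=; rewrite phiE -EFinM lte_fin.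
have nAU : ~ (th t @^-1` AU) w by case=> _ /=; rewrite phiE -EFinM lte_fin nsu.
have nAM : ~ (th t @^-1` AM) w by case=> -[_ /=]; rewrite phiE -EFinM lte_fin sl.
rewrite incrE.
rewrite (mem_set ALw) (memNset nAU) (memNset nAM) /=.
have -> : (w \in succ t) = (f (x t w) <= f (m t w)) by apply/idP/idP; rewrite inE.
by case: ifP => _ /=; ring.
Qed.

Let incr_large t w : G t w -> u * phi t w < sg t w ->
  incr t w = if f (x t w) <= f (m t w) then v * La else - (v * Ld).
Proof.
move=> Gw us; have phi0 := phi_gt0 Gw.
have nsl : (sg t w < l * phi t w) = false.
  by apply/negbTE; rewrite -leNgt (le_trans _ (ltW us))// ler_pM2r// ltW.
have nAL : ~ (th t @^-1` AL) w by case=> _ /=; rewrite phiE -EFinM lte_fin nsl.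
have AUw : (th t @^-1` AU) w by split => //=; rewrite phiE -EFinM lte_fin.
have nAM : ~ (th t @^-1` AM) w by case=> _ /=; rewrite phiE -EFinM lte_fin us.
rewrite incrE.
rewrite (memNset nAL) (mem_set AUw) (memNset nAM) /=.
have -> : (w \in succ t) = (f (x t w) <= f (m t w)) by apply/idP/idP; rewrite inE.
by case: ifP => _ /=; ring.
Qed.

Let incr_middle t w : G t w -> l * phi t w <= sg t w -> sg t w <= u * phi t w ->
  incr t w = if (w \in prog t) then - A + v * (La + Ld) else v * (La + Ld).
Proof.
move=> Gw ls su.
have nAL : ~ (th t @^-1` AL) w by case=> _ /=; rewrite phiE -EFinM lte_fin ltNge ls.
have nAU : ~ (th t @^-1` AU) w by case=> _ /=; rewrite phiE -EFinM lte_fin ltNge su.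
have AMw : (th t @^-1` AM) w.
  by split; [split => //=|]; rewrite /= phiE -EFinM lte_fin; apply/negP; rewrite -leNgt.
rewrite incrE.
rewrite (memNset nAL) (memNset nAU) (mem_set AMw) /=.
by case: ifP => _ /=; ring.
Qed.

(** As the events [G] decrease, this freezes the sum of increments once the target level is
    reached. *)
Let incr_notin t w : ~ G t w -> incr t w = 0.
Proof.
move=> nG.
have nAL : ~ (th t @^-1` AL) w by move=> [Gw _]; exact: nG.
have nAU : ~ (th t @^-1` AU) w by move=> [Gw _]; exact: nG.
have nAM : ~ (th t @^-1` AM) w by move=> [[Gw _] _]; exact: nG.
rewrite incrE.
rewrite (memNset nAL) (memNset nAU) (memNset nAM) /=.
by ring.
Qed.

(** * Pathwise bound on the potential *)

Let V t w : R := log_potential v La Ld (ln l) (ln u) (ln (phi t w)) (ln (sg t w)).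

Let case_step t w : G t w -> [\/ sg t w < l * phi t w, u * phi t w < sg t w |
  l * phi t w <= sg t w /\ sg t w <= u * phi t w].
Proof.
move=> Gw; have [?|ls] := ltP (sg t w) (l * phi t w); first by constructor 1.
by have [?|su] := ltP (u * phi t w) (sg t w); [constructor 2|constructor 3].
Qed.

Let vLaLd : 0 <= v * (La + Ld).
Proof. by rewrite mulr_ge0 ?addr_ge0// ltW. Qed.

(** Here the bounds [v <= A / ln au] and [v <= A / ln (1 / ad)] enter, through [vAu] and [vAd]. *)
Let incr_ge t w : G t w -> - A <= incr t w.
Proof.
have vLa0 : 0 < v * La by exact: mulr_gt0.
have vLd0 : 0 < v * Ld by exact: mulr_gt0.
move=> Gw; have [sl|us|[ls su]] := case_step Gw.
- by rewrite incr_small//; case: ifP => _; move: vAu A0; rewrite -/La; lra.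
- by rewrite incr_large//; case: ifP => _; move: vAd A0; rewrite -/Ld; lra.
- by rewrite incr_middle//; case: ifP => _; move: vLaLd A0; lra.
Qed.

(** Since [0 < r], progress strictly decreases [fmu]; hence it implies acceptance, which is decided
    by [f]. *)
Let prog_succ t w : G t w -> prog t w -> f (x t w) <= f (m t w).
Proof.
move=> Gw; rewrite /prog/= /Sr/= => pr; apply/ltW/fmu_lt => //.
apply: le_lt_trans pr _; rewrite phiE -EFinM lte_fin /r opprB addrC subrK.
rewrite gtr_pMl ?phi_gt0// expR_lt1 oppr_lt0 divr_gt0//.
by rewrite subr_gt0.
Qed.

Let ratio_le c t w : 0 < c -> G t w -> sg t w <= c * phi t w ->
  ln (sg t w) - ln (phi t w) <= ln c.
Proof.
move=> c0 Gw h; rewrite lerBlDr -lnM ?posrE ?phi_gt0//.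
by rewrite ler_ln ?posrE// mulr_gt0// phi_gt0.
Qed.

Let ratio_ge c t w : 0 < c -> G t w -> c * phi t w <= sg t w ->
  ln c <= ln (sg t w) - ln (phi t w).
Proof.
move=> c0 Gw h; rewrite lerBrDr -lnM ?posrE ?phi_gt0//.
by rewrite ler_ln ?posrE// mulr_gt0// phi_gt0.
Qed.

Let V_step t w : G t w -> G t.+1 w -> V t.+1 w <= V t w + incr t w.
Proof.
move=> Gw Gw'; have phi0 := phi_gt0 Gw; have phi0' := phi_gt0 Gw'.
have lphi : ln (phi t.+1 w) <= ln (phi t w) by rewrite ler_ln ?posrE.
have succ_sg : f (x t w) <= f (m t w) -> ln (sg t.+1 w) = ln (sg t w) + La.
  by move=> fx; have [_ ->] := es_success run fx; rewrite lnM ?posrE// addrC.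
have fail_sg : (f (x t w) <= f (m t w)) = false ->
    ln (sg t.+1 w) = ln (sg t w) - Ld /\ phi t.+1 w = phi t w.
  move=> /negbT; rewrite -ltNge => fx; have [mE ->] := es_failure run fx.
  by rewrite lnM ?posrE// LdE opprK addrC /phi mE.
rewrite /V; have [sl|us|[ls su]] := case_step Gw.
- have h := ratio_le l0 Gw (ltW sl).
  rewrite incr_small//; case: ifPn => [fx|/negbTE fx].
    by rewrite succ_sg//; exact: drift_small_success.
  by have [-> ->] := fail_sg fx; exact: drift_small_failure.
- have h := ratio_ge u0 Gw (ltW us).
  rewrite incr_large//; case: ifPn => [fx|/negbTE fx].
    rewrite succ_sg//; apply: drift_success => //.
    by rewrite (le_trans _ h)// ler_ln ?posrE// ltW.
  by have [-> ->] := fail_sg fx; exact: drift_large_failure.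
- have hl := ratio_ge l0 Gw ls; have hu := ratio_le u0 Gw su.
  rewrite incr_middle//; case: ifPn => [|].
    rewrite inE => pr; have fx := prog_succ Gw pr.
    rewrite succ_sg// addrA; apply: drift_progress => //.
    have [mE _] := es_success run fx.
    have : phi t.+1 w <= (1 - r) * phi t w.
      by rewrite -lee_fin EFinM -!phiE mE.
    (* As [1 - r = expR (- (A / (1 - v)))], taking logarithms gives the loss required by
       [drift_progress]. *)
    rewrite /r opprB addrC subrK -ler_ln ?posrE ?mulr_gt0 ?expR_gt0//.
    by rewrite lnM ?posrE ?expR_gt0// expRK addrC.
  (* An offspring outside [S_r] may still be accepted; either outcome raises the potential by at
     most [v * (La + Ld)]. *)
  move=> _; case: (boolP (f (x t w) <= f (m t w))) => [fx|/negbTE fx].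
    rewrite succ_sg//; apply: le_trans (drift_success v0 v1 La0 Ld0 gap hl lphi) _.
    by rewrite lerD2l ler_pM2l// lerDl ltW.
  have [-> ->] := fail_sg fx; apply: le_trans (drift_failure v0 La0 Ld0 gap hu) _.
  by rewrite lerD2l ler_pM2l// lerDr ltW.
Qed.

(** While [G] holds, [V_step] applies. At the exit step the potential may fall without bound, so the
    truncated increment is used instead: the right-hand side was at least [ln eps] before it and
    loses at most [A]. Afterwards the increments vanish. *)
Let path_bound t w : (if `[< G t w >] then V t w else ln eps - A) <=
  V 0%N w + \sum_(s <- iota 0 t) incr s w.
Proof.
elim: t => [|t IH].
  rewrite big_nil addr0 asboolT// G_phi.
  by rewrite -lte_fin -phiE; have [-> _ _] := run_init run w.
rewrite -[in iota _ _]addn1 iotaD big_cat big_seq1 addrA add0n/=.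
case: asboolP => [Gw'|nGw'].
  have Gw := G_pred Gw'; move: IH; rewrite asboolT// => IH.
  by apply: le_trans (V_step Gw Gw') _; rewrite lerD2r.
have [Gw|nGw] := pselect (G t w); last first.
  by move: IH; rewrite asboolF// incr_notin// addr0.
move: IH; rewrite asboolT// => IH.
apply: lerD (incr_ge Gw); apply: le_trans IH.
apply: (@le_trans _ _ (ln (phi t w))); last exact: log_potential_ge.
by rewrite ler_ln ?posrE ?phi_gt0//; move: Gw; rewrite G_phi => /ltW.
Qed.

Let V_ge t w : G t w -> ln eps - A <= V t w.
Proof.
move=> Gw; apply: (@le_trans _ _ (ln (phi t w))); last exact: log_potential_ge.
rewrite lerBlDr (@le_trans _ _ (ln (phi t w)))//; last by rewrite lerDl ltW.
by rewrite ler_ln ?posrE ?phi_gt0//; move: Gw; rewrite G_phi => /ltW.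
Qed.

Let V0 := potential f v au ad l u (m0, s0, S0).

Let V0E w : V 0%N w = V0.
Proof.
have phi0 : 0 < fine (fmu f m0) by apply: fine_gt0.
rewrite /V /V0 /potential /log_potential /phi; have [-> -> _] := run_init run w.
congr (_ + Num.max _ (Num.max (_ * _) (_ * _))).
  by rewrite ln_div ?posrE ?mulr_gt0// !lnM ?posrE ?mulr_gt0//.
rewrite ln_div ?posrE ?mulr_gt0// !lnM ?posrE ?mulr_gt0// LdE; ring.
Qed.

(** * Expected drift and summation over time *)

Let p (S : set O) : R := fine (P S).

Let lee_p (q : R) (S S' : set O) : measurable S -> measurable S' ->
  (q%:E * P S <= P S')%E -> q * p S <= p S'.
Proof.
by move=> mS mS' h; rewrite -lee_fin EFinM !fineK// fin_num_measure.
Qed.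

Let p_lee (q : R) (S S' : set O) : measurable S -> measurable S' ->
  (P S' <= q%:E * P S)%E -> p S' <= q * p S.
Proof.
by move=> mS mS' h; rewrite -lee_fin EFinM !fineK// fin_num_measure.
Qed.

Let pG t : p (G t) = p (th t @^-1` AL) + p (th t @^-1` AU) + p (th t @^-1` AM).
Proof.
have GE : G t = th t @^-1` AL `|` th t @^-1` AU `|` th t @^-1` AM.
  apply/seteqP; split => w.
    move=> Gw; have [sl|us|[ls su]] := case_step Gw; [left; left|left; right|right].
    - by split => //=; rewrite phiE -EFinM lte_fin.
    - by split => //=; rewrite phiE -EFinM lte_fin.
    - by split; [split => //=|]; rewrite /= phiE -EFinM lte_fin; apply/negP; rewrite -leNgt.
  by move=> [[[]|[]]|[[]]].
rewrite GE /p !measureU ?fineD ?fin_num_measure//; do ?[exact: mth];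
  do ?[by apply: measurableU; exact: mth].
- by rewrite fin_numD !fin_num_measure//; exact: mth.
- apply/seteqP; split => w // [[Gw] /=]; rewrite phiE -!EFinM !lte_fin => sl [_ us].
  have phi0 := phi_gt0 Gw.
  move: us; rewrite /= phiE -EFinM lte_fin; apply/negP; rewrite -leNgt (le_trans (ltW sl))//.
  by rewrite ler_pM2r// ltW.
- by apply/seteqP; split => w // [[[_ +]|[_ +]] [[_ +] +]].
Qed.

(** The drift is at most [- v * (La + Ld) * (pl - ptarget)] on small and large steps and at most
    [- (A * pst - v * (La + Ld))] on intermediate ones; [B] is at most both amounts. The three
    classes are weighted by their probabilities. *)
Let incr_expectation t :
  \sum_(k <- iota 0 6) coef k * p (ev t k) <= - (B * p (G t)).
Proof.
rewrite !big_cons big_nil /coef /ev/= pG.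
have p0 S : 0 <= p S by rewrite /p fine_ge0.
have hs : pl * p (th t @^-1` AL) <= p (th t @^-1` AL `&` succ t).
  by apply: lee_p; [exact: mth|apply: measurableI => //; exact: mth|exact: small_succ].
have hu : p (th t @^-1` AU `&` succ t) <= pu * p (th t @^-1` AU).
  apply: p_lee; [exact: mth|apply: measurableI => //; exact: mth|exact: large_succ].
have hm : pst * p (th t @^-1` AM) <= p (th t @^-1` AM `&` prog t).
  by apply: lee_p; [exact: mth|apply: measurableI => //; exact: mth|exact: middle_prog].
move: hs hu hm (p0 (th t @^-1` AL)) (p0 (th t @^-1` AU)) (p0 (th t @^-1` AM)).
move: (p _) (p _) (p _) (p _) (p _) (p _) => pMR pM pU pUS pLS pL.
move=> hs hu hm pL0 pU0 pM0.
have h1 := ler_wpM2l vLaLd hs; have h2 := ler_wpM2l vLaLd hu.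
have h3 := ler_wpM2l (ltW A0) hm.
have Bp' : B <= v * ((La + Ld) * (pl - ptarget au ad)).
  by rewrite pt_gap mulrA -LadE.
have k1 := ler_wpM2r pL0 Bp'; have k2 := ler_wpM2r pU0 Bp'.
have k3 := ler_wpM2r pM0 BA.
have puE : pu = 2 * ptarget au ad - pl by move: plu; lra.
(* [ptE] replaces [Ld] by [(La + Ld) * ptarget]; for large steps [pl + pu = 2 * ptarget] then leads
   to the same amount. *)
have e1 : v * (La + Ld) * (pl * pL) - v * Ld * pL =
   v * ((La + Ld) * (pl - ptarget au ad)) * pL.
  by rewrite -{2}ptE; ring.
have e2 : v * Ld * pU - v * (La + Ld) * (pu * pU) =
   v * ((La + Ld) * (pl - ptarget au ad)) * pU.
  by rewrite puE -{1}ptE; ring.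
rewrite LadE in k3.
have e3 : (A * pst - v * (La + Ld)) * pM = A * (pst * pM) - v * (La + Ld) * pM by ring.
lra.
Qed.

Let K := V0 - ln eps + A.

(** Expectations in [path_bound], with each expected increment bounded by [incr_expectation], give
    that [K] is at least [B] times the sum. *)
Lemma sum_survival_le n : \sum_(t < n) p (G t) <= K / B.
Proof.
have := @sum_indic_ge0 _ _ _ P _ [seq (s, k) | s <- iota 0 n, k <- iota 0 6]
  (fun i => coef i.2) (fun i => ev i.1 i.2) K (fun i => mev i.1 i.2).
rewrite !big_allpairs => h.
have {}h : 0 <= K + \sum_(s <- iota 0 n) \sum_(k <- iota 0 6) coef k * p (ev s k).
  apply: h => w; rewrite big_allpairs.
  (* Both branches of [path_bound] are at least [ln eps - A], which makes the combination
     nonnegative at every [w]. *)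
  have := path_bound n w; rewrite V0E; case: asboolP => [/V_ge|_];
    rewrite /incr /K; lra.
rewrite ler_pdivlMr// mulrC mulr_sumr -(big_mkord xpredT (fun t => B * p (G t))).
rewrite /index_iota subn0.
have : \sum_(s <- iota 0 n) \sum_(k <- iota 0 6) coef k * p (ev s k) <=
    \sum_(s <- iota 0 n) - (B * p (G s)).
  by apply: ler_sum => s _; exact: incr_expectation.
rewrite sumrN; lra.
Qed.

Lemma expected_level_hitting_time :
  (\int[P]_w hitting_time (fun t => fmu f (m t w) <= eps%:E) <= (K / B)%:E)%E.
Proof.
apply: (@hitting_time_bound _ _ _ P _ G) => [t|t w nQ|n].
- exact: (mth t mAG).
- by rewrite /G/= ltNge; apply/negP/nQ.
- exact: sum_survival_le.
Qed.

Lemma expected_distance_hitting_time (xs : 'rV[R]_d) : (forall y, f xs <= f y) ->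
  level_reached f a b eps ->
  (\int[P]_w hitting_time (fun t => (enorm (m t w - xs) <= 2 * Cu * eps)%R)
   <= (K / B)%:E)%E.
Proof.
move=> xsmin lev.
pose N t : set O := [set w | (fmu f (m t w) <= 0)%E].
have mG t : measurable (G t) by exact: (mth t mAG).
have mN t : measurable (N t) by exact: measurable_run_fmu_le.
have mGN t : measurable (G t `|` N t) by exact: measurableU.
have PN t : P (N t) = 0%E.
  by apply: (run_fmu_gt0 d_gt0 mf run); case/andP: fmu0_fin.
(* Adding the null events [N t] does not increase the probabilities and sets aside means with
   [fmu = 0], which [sublevel_near_minimizer] does not cover. *)
apply: (@hitting_time_bound _ _ _ P _ (fun t => G t `|` N t)) => [//|t w nQ|n].
  have [?|eps_ge] := ltP eps%:E (fmu f (m t w)); first by left.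
  have [?|fmu0] := leP (fmu f (m t w)) 0%E; first by right.
  exfalso; apply: (nQ t) => //; apply: (sublevel_near_minimizer HA1) => //.
  by rewrite (le_trans (run_fmu_le0 mf run t w))//; case/andP: Xm0.
apply: le_trans (sum_survival_le n); apply: ler_sum => t _.
rewrite -lee_fin /p !fineK ?fin_num_measure//.
by apply: le_trans (measureU2 _ _ _) _ => //; rewrite [X in (_ + X)%E]PN adde0.
Qed.

End expected_hitting_time.

(** * Choice of the step-size range and conclusion *)

Theorem theorem4p5 (R : realType) (d : nat) (kappa au ad : R)
    (f : 'rV[R]_d -> R) (a : R) (b : \bar R) (Cl Cu plim : R)
    (m0 : 'rV[R]_d) (s0 : R) (S0 : 'M[R]_d)
    (dO : measure_display) (O : measurableType dO) (P : probability O R)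
    (m : nat -> {RV P >-> 'rV[R]_d}) (sg : nat -> {RV P >-> R})
    (Sig : nat -> {RV P >-> 'M[R]_d}) (x : nat -> {RV P >-> 'rV[R]_d})
    (E : Type) (rule : @cov_rule R d E) (seed : nat -> O -> E) (pl pu : R) :
  (0 < d)%N -> 1 <= kappa -> 1 < au -> 0 < ad < 1 ->
  0 <= a -> (a%:E < b)%E ->
  A1 f a b Cl Cu -> A2 f kappa au ad a b plim ->
  Xab f a b m0 -> 0 < s0 -> Skappa kappa S0 ->
  es_run m sg Sig x kappa au ad f m0 s0 S0 rule seed ->
  0 < pu -> pu < ptarget au ad -> ptarget au ad < pl -> pl < plim ->
  pl + pu = 2 * ptarget au ad ->
  exists l u : R,
    [/\ 0 < l, (l%:E <= sigbar_l f kappa a b pl)%E,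
        (sigbar_u f kappa a b pu <= u%:E)%E, au / ad <= u / l &
    forall A v : R, 0 < A -> 0 < v ->
      v < Num.min 1 (Num.min (A / ln (1 / ad)) (A / ln au)) ->
      let r := 1 - expR (- (A / (1 - v))) in
      let B := Num.min (A * fine (pstar f kappa a b l u r) - v * ln (au / ad))
                       (v * ((pl - pu) / 2) * ln (au / ad)) in
      B < A -> 0 < B ->
      forall eps : R, 0 < eps -> a <= eps ->
        (eps%:E < fmu f m0)%E -> (fmu f m0 <= b)%E ->
        let phi0 := fine (fmu f m0) in
        let bound :=
          (potential f v au ad l u (m0, s0, S0) - ln eps + A) / B in
        let CR := B in
        let CT := A / B + v / B * Num.max 0
          (Num.max (ln (au * l * phi0 / s0)) (ln (s0 / (ad * u * phi0)))) in
        [/\ (\int[P]_w hitting_time (fun t => fmu f (m t w) <= eps%:E)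
              <= bound%:E)%E,
            (\int[P]_w hitting_time (fun t => fmu f (m t w) <= eps%:E)
              <= (CT + CR^-1 * ln (phi0 / eps))%:E)%E,
            bound = CT + CR^-1 * ln (phi0 / eps) &
            forall xs : 'rV[R]_d, (forall y, f xs <= f y) ->
              level_reached f a b eps ->
              (\int[P]_w
                 hitting_time (fun t => (enorm (m t w - xs) <= 2 * Cu * eps)%R)
               <= bound%:E)%E]].
Proof.
move=> d0 kappa1 au1 ad01 a0 ab HA1 HA2 Xm0 s00 S0k run pu0 puptar ptarpl plplim plu.
have /andP[ad0 ad1] := ad01.
have au0 : 0 < au by exact: lt_trans au1.
have La0 : 0 < ln au by exact: ln_gt0.
have Ld0 : 0 < ln (1 / ad) by rewrite div1r lnV ?posrE// oppr_gt0 ln_lt0.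
(* [l] comes from [A2] and [u1] from the volume bound; both are fixed before [A] and [v]. *)
have [l l0 Hl] := plower_ge_near0 HA2 plplim.
have [u1 u10 Hu] := pupper_le_large kappa d0 a0 HA1 pu0.
(* Enlarging [u1] secures [u / l >= au / ad] and keeps the bound on [pupper]. *)
pose u := Num.max u1 (l * (au / ad)).
have u1u : u1 <= u by rewrite le_max lexx.
have u0 : 0 < u by exact: lt_le_trans u1u.
have lu : au / ad <= u / l by rewrite ler_pdivlMr// mulrC le_max lexx orbT.
exists l, u; split => //.
(* [l] belongs to the set whose supremum is [sigbar_l], and [u] to the one whose infimum is
   [sigbar_u]. *)
- by apply: ereal_sup_ubound; exists l => //; split => //; exact: Hl.
- by apply: ereal_inf_lbound; exists u => //; split => //; exact: Hu.
move=> A v A0 v0; rewrite !lt_min => /and3P[v1 vAd vAu] r B BA B0 eps eps0 aeps epsm0 m0b.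
move=> phi0 bound CR CT.
have {}vAd : v * ln (1 / ad) <= A by rewrite -ler_pdivlMr// ltW.
have {}vAu : v * ln au <= A by rewrite -ler_pdivlMr// ltW.
have pl0 : 0 <= pl by apply/ltW/(lt_trans pu0)/(lt_trans puptar).
have Hu' s : u <= s -> (pupper f kappa a b s <= pu%:E)%E.
  by move=> us; apply: Hu; exact: le_trans us.
have B1 : B <= A * fine (pstar f kappa a b l u r) - v * ln (au / ad).
  by rewrite /B ge_min lexx.
have B2 : B <= v * ((pl - pu) / 2) * ln (au / ad) by rewrite /B ge_min lexx orbT.
have phi00 : 0 < phi0 by apply/fine_gt0/(Xab_fmu a0 HA1 Xm0).
have boundE : bound = CT + CR^-1 * ln (phi0 / eps).
  have maxE (X Y : R) :
      Num.max 0 (Num.max (v * X) (v * Y)) = v * Num.max 0 (Num.max X Y).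
    by rewrite !maxr_pMr ?mulr0 ?ltW.
  rewrite /bound /CT /CR /potential -/phi0 maxE [ln (phi0 / eps)]ln_div ?posrE//.
  by field; rewrite gt_eqF.
have hit := expected_level_hitting_time d0 au1 ad01 a0 HA1 Xm0 s00 S0k run l0 u0 lu
  Hl Hu' pl0 (ltW pu0) plu A0 v0 v1 vAd vAu eps0 aeps epsm0 B0 B1 B2.
split; rewrite -?boundE//.
by move=> xs xsmin lev; apply: (expected_distance_hitting_time d0 au1 ad01 a0 HA1 Xm0
  s00 S0k run l0 u0 lu Hl Hu' pl0 (ltW pu0) plu A0 v0 v1 vAd vAu eps0 aeps epsm0 B0 B1 B2).
Qed.
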